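(* Let $\{u^k=(x^k,y^k,\lambda^k)\}_{k\ge 0}$ be generated by the proximal ADMM (described in the context) under the stated assumptions on the spaces, operators and functions, and assume the minimization problem has a KKT point. Then $\{u^k\}$ is bounded and there exists a constant $C>0$ such that $$d_G(u^k,F^{-1}(0))\le C\|\Delta u^k\|_G\qquad\text{for all }k\ge1,$$ provided any one of the following conditions holds: (i) $\sigma_g>0$, $A$ and $B^*$ are coercive, $g$ is differentiable and its gradient is Lipschitz continuous over bounded sets; (ii) $\sigma_f>0$, $\sigma_g>0$, $B^*$ is coercive, $g$ is differentiable and its gradient is Lipschitz continuous over bounded sets; (iii) $\lambda^0=0$, $\sigma_f>0$, $\sigma_g>0$, $M^*$ restricted to $\mathcal N(M^* )^\perp$ is coercive, both $f$ and $g$ are differentiable and their gradients are Lipschitz continuous over bounded sets; (iv) $\lambda^0=0$, $\sigma_g>0$, $A$ is coercive, $M^*$ restricted to $\mathcal N(M^* )^\perp$ is coercive, both $f$ and $g$ are differentiable and their gradients are Lipschitz continuous over bounded sets. Consequently (under any one of these conditions) there exist $C>0$, $0<q<1$ and a KKT point $u^\dagger=(x^\dagger,y^\dagger,\lambda^\dagger)$ of the problem such that $$\|u^k-u^\dagger\|\le Cq^k\quad\text{and}\quad |H(x^k,y^k)-H_*|\le Cq^k$$ for all $k\ge1$.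
   Context: Setting. $\mathcal X,\mathcal Y,\mathcal Z$ are real Hilbert spaces (possibly infinite-dimensional), $c\in\mathcal Z$, $\rho>0$, $A:\mathcal X\to\mathcal Z$ and $B:\mathcal Y\to\mathcal Z$ are bounded linear operators with adjoints $A^*,B^*$, $P:\mathcal X\to\mathcal X$ and $Q:\mathcal Y\to\mathcal Y$ are bounded linear positive semi-definite self-adjoint operators, and $f:\mathcal X\to(-\infty,\infty]$, $g:\mathcal Y\to(-\infty,\infty]$ are proper, lower semi-continuous, convex. For a bounded linear positive semi-definite self-adjoint operator $D$ write $\|u\|_D^2:=\langle u,Du\rangle$. Problem: minimize $H(x,y):=f(x)+g(y)$ subject to $Ax+By=c$. A KKT point is a triple $(\bar x,\bar y,\bar\lambda)\in\mathcal X\times\mathcal Y\times\mathcal Z$ with $-A^*\bar\lambda\in\partial f(\bar x)$, $-B^*\bar\lambda\in\partial g(\bar y)$, $A\bar x+B\bar y=c$. If $(\bar x,\bar y,\bar\lambda)$ is a KKT point then $(\bar x,\bar y)$ solves the problem; $H_*=H(\bar x,\bar y)$ denotes the minimum value. Proximal ADMM: from an arbitrary initial guess $(x^0,y^0,\lambda^0)\in\mathcal X\times\mathcal Y\times\mathcal Z$, for $k\ge0$, $$x^{k+1}\in\arg\min_{x\in\mathcal X}\Big\{f(x)+\langle\lambda^k,Ax\rangle+\tfrac{\rho}{2}\|Ax+By^k-c\|^2+\tfrac12\|x-x^k\|_P^2\Big\},$$ $$y^{k+1}\in\arg\min_{y\in\mathcal Y}\Big\{g(y)+\langle\lambda^k,By\rangle+\tfrac{\rho}{2}\|Ax^{k+1}+By-c\|^2+\tfrac12\|y-y^k\|_Q^2\Big\},$$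 $$\lambda^{k+1}=\lambda^k+\rho(Ax^{k+1}+By^{k+1}-c),$$ where it is assumed that minimizers of the subproblems exist, so that the sequence is well defined. Notation: $\widehat Q:=\rho B^*B+Q$, $G(x,y,\lambda):=(Px,\widehat Qy,\lambda/\rho)$, so $\|u\|_G^2=\|x\|_P^2+\|y\|_{\widehat Q}^2+\frac1\rho\|\lambda\|^2$ for $u=(x,y,\lambda)$; $\|\cdot\|$ on $\mathcal X\times\mathcal Y\times\mathcal Z$ is the product Hilbert norm. For $k\ge1$: $\Delta u^k:=u^k-u^{k-1}$. $$F(x,y,\lambda):=\big(\partial f(x)+A^*\lambda\big)\times\big(\partial g(y)+B^*\lambda\big)\times\{Ax+By-c\},$$ $F^{-1}(0)=\{u:0\in F(u)\}$ is the set of KKT points, and $d_G(u,F^{-1}(0)):=\inf_{\bar u\in F^{-1}(0)}\|u-\bar u\|_G$. The modulus of convexity $\sigma_\varphi\ge0$ of a proper convex function $\varphi$ is the largest number $s$ such that $\varphi(tx+(1-t)y)+s\,t(1-t)\|x-y\|^2\le t\varphi(x)+(1-t)\varphi(y)$ for all $x,y\in\mathrm{dom}(\varphi)$ and $0\le t\le1$. A linear operator $L:\mathcal V\to\mathcal H$ between Hilbert spaces is coercive if $\|Lv\|\to\infty$ whenever $\|v\|\to\infty$ (equivalently, there is $s>0$ with $s\|v\|\le\|Lv\|$ for all $v\in\mathcal V$). $M:\mathcal X\times\mathcal Y\to\mathcal Z$ is $M(x,y):=Ax+By$, so $M^*z=(A^*z,B^*z)$, and $\mathcal N(M^* )$ is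 the null space of $M^*$. *)

(* Defs.v *)
From HB Require Import structures.
From mathcomp Require Import all_boot all_order all_algebra.
From mathcomp Require Import all_classical all_reals all_analysis.

Set Implicit Arguments.
Unset Strict Implicit.
Unset Printing Implicit Defensive.

Import Order.TTheory GRing.Theory Num.Theory.
Import numFieldNormedType.Exports.

Local Open Scope classical_set_scope.
Local Open Scope ring_scope.

HB.mixin Record CompleteNormedModule_isHilbert (R : realType) (V : Type)
    of CompleteNormedModule R V := {
  inner : {dot V for (@idfun R)} ;
  innerxx : forall x : V, inner x x = `|x| ^+ 2
}.

#[short(type="hilbertType")]
HB.structure Definition Hilbert (R : realType) :=
  {V of CompleteNormedModule R V & CompleteNormedModule_isHilbert R V}.

Notation "''[' u , v ]" := (inner u v) : ring_scope.

Section operators.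
Context {R : realType}.
Implicit Types V W : hilbertType R.

Definition adjoint V W (L : V -> W) (w : W) : V :=
  get [set v | forall u, '[L u, w] = '[u, v]].

Lemma adjointE V W (L : V -> W) (w : W) (v : V) :
  (forall u, '[L u, w] = '[u, v]) -> adjoint L w = v.
Proof.
move=> Lwv; rewrite /adjoint; case: xgetP => [v' _ /= Lwv'|/(_ v)]; last first.
  by move=> /(_ Lwv).
apply/eqP; rewrite -subr_eq0 -normr_eq0 -sqrf_eq0 -innerxx.
by rewrite linearBr /= -Lwv -Lwv' subrr.
Qed.

Definition psd_selfadjoint V (D : V -> V) : Prop :=
  (forall u v, '[D u, v] = '[u, D v]) /\ (forall u, 0 <= '[u, D u]).

(* `|u|_D ^ 2 *)
Definition sqnorm_op V (D : V -> V) (u : V) : R := '[u, D u].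

(* |L v| -> +oo as |v| -> +oo, for v ranging over S. The norms are arguments
   because the norm MathComp-Analysis puts on a product is the max norm. *)
Definition coercive_on (V W : Type) (normV : V -> R) (normW : W -> R)
    (S : set V) (L : V -> W) : Prop :=
  forall K : R, exists r : R, forall v, S v -> r < normV v -> K < normW (L v).

Definition coercive V W (L : V -> W) : Prop :=
  coercive_on Num.norm Num.norm setT L.

End operators.

Section products.
Context {R : realType}.
Variables X Y Z : hilbertType R.

Definition prod_norm (p : X * Y) : R := Num.sqrt (`|p.1| ^+ 2 + `|p.2| ^+ 2).

Definition triple_inner (u v : X * Y * Z) : R :=
  '[u.1.1, v.1.1] + '[u.1.2, v.1.2] + '[u.2, v.2].

Definition triple_norm (u : X * Y * Z) : R := Num.sqrt (triple_inner u u).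

End products.

Section convex_analysis.
Context {R : realType}.
Variable V : hilbertType R.
Implicit Types phi : V -> \bar R.

Definition effdom phi : set V := [set x | (phi x < +oo)%E].

Definition proper_fun phi : Prop :=
  (forall x, (-oo < phi x)%E) /\ effdom phi !=set0.

Definition convex_with phi (s : R) : Prop :=
  forall (x y : V) (t : R), effdom phi x -> effdom phi y -> 0 <= t <= 1 ->
  (phi (t *: x + (1 - t) *: y)%R + (s * t * (1 - t) * `|x - y| ^+ 2)%:E
     <= t%:E * phi x + (1 - t)%:E * phi y)%E.

Definition convex_fun phi : Prop := convex_with phi 0.

(* Extended-valued: it is +oo when the domain of phi is a single point. *)
Definition convexity_modulus phi : \bar R :=
  ereal_sup [set s%:E | s in [set s : R | convex_with phi s]].

Definition subdiff phi (x : V) : set V :=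
  [set v | forall y, (phi x + ('[v, y - x])%:E <= phi y)%E].

Definition argmin phi : set V := [set x | forall y, (phi x <= phi y)%E].

Definition gradient phi (x : V) : V :=
  get [set v | forall h, 'd (fine \o phi) x h = '[v, h]].

(* Differentiable on the whole space, hence finite everywhere. *)
Definition diff_fun phi : Prop :=
  forall x : V, phi x \is a fin_num /\ differentiable (fine \o phi) x.

Definition lipschitz_gradient_bounded phi : Prop :=
  forall S : set V, bounded_set S -> [lipschitz gradient phi x | x in S].

End convex_analysis.

Section padmm.
Context {R : realType}.
Variables X Y Z : hilbertType R.
Variables (rho : R) (c : Z) (A : X -> Z) (B : Y -> Z) (P : X -> X) (Q : Y -> Y).
Variables (f : X -> \bar R) (g : Y -> \bar R).

Local Notation As := (adjoint A).
Local Notation Bs := (adjoint B).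

Definition objective (x : X) (y : Y) : \bar R := (f x + g y)%E.

Definition min_value : \bar R :=
  ereal_inf [set objective p.1 p.2 | p in [set p : X * Y | A p.1 + B p.2 = c]].

Definition kkt_point (u : X * Y * Z) : Prop :=
  [/\ subdiff f u.1.1 (- As u.2), subdiff g u.1.2 (- Bs u.2)
    & A u.1.1 + B u.1.2 = c].

Definition kkt_map (u : X * Y * Z) : set (X * Y * Z) :=
  [set v + As u.2 | v in subdiff f u.1.1]
  `*` [set w + Bs u.2 | w in subdiff g u.1.2]
  `*` [set A u.1.1 + B u.1.2 - c].

Definition kkt_zeros : set (X * Y * Z) := [set u | kkt_map u 0].

Lemma kkt_zerosE : kkt_zeros = [set u | kkt_point u].
Proof.
apply/seteqP; split=> -[[x y] l] /=.
  move=> [[[v fv /= v0] [w gw /= w0]] /= r0]; split=> /=.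
  - by rewrite -(addrK (As l) v) v0 sub0r in fv.
  - by rewrite -(addrK (Bs l) w) w0 sub0r in gw.
  - by apply/eqP; rewrite -subr_eq0 -r0.
move=> [/= fx gy r]; split; last by rewrite /= r subrr.
by split => /=; [exists (- As l)|exists (- Bs l)]; rewrite ?addNr.
Qed.

Definition Qhat (y : Y) : Y := rho *: Bs (B y) + Q y.

Definition Gop (u : X * Y * Z) : X * Y * Z :=
  (P u.1.1, Qhat u.1.2, rho^-1 *: u.2).

Definition Gnorm (u : X * Y * Z) : R := Num.sqrt (triple_inner u (Gop u)).

Definition Gdist (u : X * Y * Z) (S : set (X * Y * Z)) : R :=
  inf [set Gnorm (u - v) | v in S].

Definition x_subproblem (xk : X) (yk : Y) (lk : Z) (x : X) : \bar R :=
  (f x + ('[lk, A x] + rho / 2 * `|A x + B yk - c| ^+ 2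
          + 2^-1 * sqnorm_op P (x - xk))%:E)%E.

Definition y_subproblem (xk1 : X) (yk : Y) (lk : Z) (y : Y) : \bar R :=
  (g y + ('[lk, B y] + rho / 2 * `|A xk1 + B y - c| ^+ 2
          + 2^-1 * sqnorm_op Q (y - yk))%:E)%E.

Definition proximal_admm (u : nat -> X * Y * Z) : Prop :=
  forall k : nat,
  let: (xk, yk, lk) := u k in let: (xk1, yk1, lk1) := u k.+1 in
  [/\ argmin (x_subproblem xk yk lk) xk1,
      argmin (y_subproblem xk1 yk lk) yk1
    & lk1 = lk + rho *: (A xk1 + B yk1 - c)].

(* The adjoint of (x, y) |-> A x + B y for the product inner product. *)
Definition Mstar (z : Z) : X * Y := (As z, Bs z).

Definition Mstar_ker_perp : set Z :=
  [set z | forall w, Mstar w = 0 -> '[w, z] = 0].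

Definition Mstar_coercive : Prop :=
  coercive_on Num.norm (@prod_norm R X Y) Mstar_ker_perp Mstar.

Definition condition_i : Prop :=
  [/\ (0 < convexity_modulus g)%E, coercive A, coercive Bs, diff_fun g
    & lipschitz_gradient_bounded g].

Definition condition_ii : Prop :=
  [/\ (0 < convexity_modulus f)%E, (0 < convexity_modulus g)%E, coercive Bs,
      diff_fun g & lipschitz_gradient_bounded g].

Definition condition_iii (l0 : Z) : Prop :=
  [/\ l0 = 0, (0 < convexity_modulus f)%E, (0 < convexity_modulus g)%E,
      Mstar_coercive
    & [/\ diff_fun f, lipschitz_gradient_bounded f,
          diff_fun g & lipschitz_gradient_bounded g]].

Definition condition_iv (l0 : Z) : Prop :=
  [/\ l0 = 0, (0 < convexity_modulus g)%E, coercive A, Mstar_coercive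
    & [/\ diff_fun f, lipschitz_gradient_bounded f,
          diff_fun g & lipschitz_gradient_bounded g]].

End padmm.

(* Main.v *)
Require Import Defs.
From HB Require Import structures.
From mathcomp Require Import all_boot all_order all_algebra.
From mathcomp Require Import all_classical all_reals all_analysis.
From mathcomp Require Import ring lra.

(** Fix a KKT point [ub] and follow the energy
      [|u k.+1 - ub|_G ^ 2 + |y k.+1 - y k|_Q ^ 2].
    Monotonicity of the subdifferentials of [f] and [g], applied between an
    iterate and [ub] and between two consecutive iterates, shows that the energy
    decreases at each step by at least the squared step length
    [|u k.+2 - u k.+1|_G ^ 2], plus squared primal errors weighted by the convexity
    moduli ([energy_descent]). This bounds the iterates.

    Conversely, the step length controls the error. The iterate [u k.+1] satisfies
    the KKT inclusions up to residuals of the order of the step, and [kkt_gap]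
    bounds the squared primal errors by the step times the total error. Strong
    convexity of [f] bounds the error in [x] directly; coercivity of [A] bounds it,
    through the constraint, by the step and the error in [y]. If the multiplier error is moreover bounded
    by the step and the primal errors, the whole error is at most a constant times
    the step ([error_bound]). The energy is then bounded by a multiple of its own
    decrease, so it decays geometrically ([linear_rate]), and the objective values
    follow because the subgradients stay bounded ([objective_error_le]).

    The four conditions differ only in how the multiplier is controlled. Since the
    iterates are bounded, the gradients are uniformly Lipschitz along them, and the
    adjoint operators applied to the multiplier error are bounded by the step and
    the primal errors ([dual_error_le]). In (i) and (ii) the coercive adjoint of [B]
    is inverted, with any KKT point. In (iii) and (iv) the multipliers
    remain orthogonal to the kernel of [Mstar] because the first one is [0]; the KKT
    multiplier is projected onto that orthogonal complement, on which [Mstar] is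
    bounded below. So a single point [ub] is the limit, and the distance to the set
    of KKT points is estimated by the distance to [ub].

    The adjoints, defined by choice, are given their meaning by the Riesz
    representation theorem, which like the projection of the multiplier comes from
    [orthogonal_projection]. *)

Import Order.TTheory GRing.Theory Num.Theory.
Import numFieldNormedType.Exports.

Local Open Scope classical_set_scope.
Local Open Scope ring_scope.

Set Implicit Arguments.
Unset Strict Implicit.

(** * Hilbert spaces: projection, Riesz representation, adjoints *)

Section inner_product.
Context {R : realType} {V : hilbertType R}.
Implicit Types (u v w : V) (a : R).

Lemma innerC u v : '[u, v] = '[v, u].
Proof. by rewrite (hermC (theta := idfun)) expr0 mul1r. Qed.

Lemma innerDl u v w : '[u + v, w] = '[u, w] + '[v, w].
Proof. exact: linearDl. Qed.

Lemma innerDr u v w : '[w, u + v] = '[w, u] + '[w, v].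
Proof. exact: linearDr. Qed.

Lemma innerNl u w : '[- u, w] = - '[u, w].
Proof. exact: linearNl. Qed.

Lemma innerNr u w : '[w, - u] = - '[w, u].
Proof. exact: linearNr. Qed.

Lemma innerBl u v w : '[u - v, w] = '[u, w] - '[v, w].
Proof. exact: linearBl. Qed.

Lemma innerBr u v w : '[w, u - v] = '[w, u] - '[w, v].
Proof. exact: linearBr. Qed.

Lemma innerZl a u w : '[a *: u, w] = a * '[u, w].
Proof. exact: linearZl_LR. Qed.

Lemma innerZr a u w : '[w, a *: u] = a * '[w, u].
Proof. exact: linearZr_LR. Qed.

Lemma inner0l w : '[0, w] = 0 :> R.
Proof. exact: linear0l. Qed.

Lemma inner0r w : '[w, 0] = 0 :> R.
Proof. exact: linear0r. Qed.

Lemma inner_inj v w : (forall u, '[u, v] = '[u, w]) -> v = w.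
Proof.
move=> vw; apply/eqP; rewrite -subr_eq0 -normr_eq0 -sqrf_eq0 -innerxx.
by rewrite innerBr vw subrr.
Qed.

Lemma sqr_normD u v : `|u + v| ^+ 2 = `|u| ^+ 2 + 2 * '[u, v] + `|v| ^+ 2.
Proof. by rewrite -!innerxx innerDl !innerDr (innerC v u); ring. Qed.

Lemma sqr_normB u v : `|u - v| ^+ 2 = `|u| ^+ 2 - 2 * '[u, v] + `|v| ^+ 2.
Proof. by rewrite sqr_normD innerNr normrN; ring. Qed.

Lemma cauchy_schwarz u v : `|'[u, v]| <= `|u| * `|v|.
Proof.
have [->|v0] := eqVneq v 0; first by rewrite inner0r !normr0 mulr0.
have nv : 0 < `|v| ^+ 2 by rewrite exprn_gt0// normr_gt0.
rewrite -(@ler_pXn2r _ 2)// ?nnegrE ?mulr_ge0// exprMn real_normK ?num_real//.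
have := mulr_ge0 (sqr_ge0 `|u - ('[u, v] / `|v| ^+ 2) *: v|) (ltW nv).
rewrite sqr_normB innerZr normrZ exprMn real_normK ?num_real//.
set s := '[u, v]; set n := `|v|; suff -> : (`|u| ^+ 2 - 2 * (s / n ^+ 2 * s) +
  (s / n ^+ 2) ^+ 2 * n ^+ 2) * n ^+ 2 = `|u| ^+ 2 * n ^+ 2 - s ^+ 2.
  by rewrite subr_ge0.
by field; rewrite normr_eq0.
Qed.

Lemma inner_le u v : '[u, v] <= `|u| * `|v|.
Proof. by rewrite (le_trans (ler_norm _))// cauchy_schwarz. Qed.

End inner_product.

Section orthogonal_projection.
Context {R : realType} {V : hilbertType R}.

Definition subspace (S : set V) :=
  S !=set0 /\ forall a x y, S x -> S y -> S (a *: x + y).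

(** A minimizing sequence for the distance from [x] to [S] is Cauchy by the
    parallelogram identity, because the midpoint of two of its terms lies in [S]
    and is therefore at least as far from [x]; perturbing the nearest point
    along [s] shows that the residual is orthogonal to [s]. *)
Lemma orthogonal_projection (S : set V) (x : V) : subspace S -> closed S ->
  exists2 p, S p & forall s, S s -> '[x - p, s] = 0.
Proof.
move=> [[s0 Ss0] Slin] Scl.
pose D : set R := [set `|x - s| ^+ 2 | s in S].
have Dlb : lbound D 0 by move=> _ [s _ <-]; exact: sqr_ge0.
have Dinf : has_inf D by split; [exists (`|x - s0| ^+ 2), s0|exists 0].
have dle s : S s -> inf D <= `|x - s| ^+ 2.
  by move=> Ss; apply: ge_inf; [exists 0|exists s].
have near_min n : exists s, S s /\ `|x - s| ^+ 2 < inf D + n.+1%:R^-1.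
  have e0 : 0 < (n.+1%:R : R)^-1 by rewrite invr_gt0.
  by have [_ [s Ss <-] lt] := inf_adherent e0 Dinf; exists s.
have [s_ s_P] := choice near_min.
have s_cauchy m n :
    `|s_ m - s_ n| ^+ 2 <= 2 * (m.+1%:R^-1 + n.+1%:R^-1).
  have Smid : S (2^-1 *: s_ m + 2^-1 *: s_ n).
    have S0 : S 0 by rewrite -(subrr s0) addrC -scaleN1r; apply: Slin.
    have Shalf k : S (2^-1 *: s_ k).
      by rewrite -[_ *: _]addr0; apply: Slin => //; apply: (s_P k).1.
    by apply: Slin; [exact: (s_P m).1|exact: Shalf].
  have := dle _ Smid; have := (s_P m).2; have := (s_P n).2.
  have -> : s_ m - s_ n = (x - s_ n) - (x - s_ m).
    by rewrite opprB [RHS]addrC addrA subrK.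
  have -> : x - (2^-1 *: s_ m + 2^-1 *: s_ n)
          = 2^-1 *: ((x - s_ n) + (x - s_ m)).
    rewrite addrACA -opprD scalerBr (addrC (s_ n)) !scalerDr; congr (_ - _).
    have half : 2^-1 + 2^-1 = 1 :> R by field.
    by rewrite -scalerDl half scale1r.
  set a := x - s_ n; set b := x - s_ m.
  rewrite (sqr_normB a b) normrZ exprMn (sqr_normD a b) gtr0_norm ?invr_gt0//.
  by move: (n.+1%:R^-1) (m.+1%:R^-1) => i j h1 h2 h3; lra.
have s_cvg : cvg (s_ @ \oo).
  apply: cauchy_cvg; apply: cauchy_exP => e e0.
  have e4 : 0 < e ^+ 2 / 4 by rewrite divr_gt0 ?exprn_gt0.
  have [N _ small] := near_infty_natSinv_lt (PosNum e4).
  exists (s_ N); exists N => // n /= nN.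
  have : `|s_ N - s_ n| ^+ 2 < e ^+ 2.
    have := small _ nN; have := small _ (leqnn N); have := s_cauchy N n.
    by rewrite /=; move: (N.+1%:R^-1) (n.+1%:R^-1) => i j h0 h1 h2; lra.
  by rewrite ltr_pXn2r ?nnegrE ?(ltW e0)// -ball_normE.
pose p := lim (s_ @ \oo).
have Sp : S p.
  by apply: (closed_cvg S) s_cvg => //; apply: nearW => n; exact: (s_P n).1.
have pmin s : S s -> `|x - p| ^+ 2 <= `|x - s| ^+ 2.
  move=> Ss; apply: le_trans (dle _ Ss).
  have dp : (fun n => `|x - s_ n| ^+ 2) @ \oo --> `|x - p| ^+ 2.
    rewrite expr2; under eq_fun do rewrite expr2.
    by apply: cvgM; apply: cvg_norm; apply: cvgB => //; exact: cvg_cst.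
  have dd : (fun n => inf D + n.+1%:R^-1) @ \oo --> inf D + 0.
    by apply: cvgD; [exact: cvg_cst|exact: cvg_harmonic].
  rewrite addr0 in dd; apply: ler_cvg_to dp dd _.
  by apply: nearW => n; apply: ltW; exact: (s_P n).2.
exists p => // s Ss; apply/eqP.
have [->|s_neq0] := eqVneq s 0; first by rewrite inner0r.
have ns : 0 < `|s| ^+ 2 by rewrite exprn_gt0// normr_gt0.
have := pmin _ (Slin ('[x - p, s] / `|s| ^+ 2) _ _ Ss Sp).
have swap k : x - (k *: s + p) = (x - p) - k *: s.
  by rewrite opprD addrCA [LHS]addrC.
rewrite swap -(ler_pM2r ns) (sqr_normB (x - p)) innerZr normrZ exprMn.
rewrite real_normK ?num_real//.
set a := '[_, s]; set n := `|s|; set d := `|x - p|.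
have -> : (d ^+ 2 - 2 * (a / n ^+ 2 * a) + (a / n ^+ 2) ^+ 2 * n ^+ 2) * n ^+ 2
    = d ^+ 2 * n ^+ 2 - a ^+ 2 by field; rewrite normr_eq0.
rewrite -subr_ge0 -sqrf_eq0 => h; rewrite eq_le sqr_ge0 andbT; lra.
Qed.

End orthogonal_projection.

Section bounded_operators.
Context {R : realType}.

Definition bounded_by {V W : normedModType R} (K : R) (L : V -> W) :=
  forall v, `|L v| <= K * `|v|.

Lemma continuous_bounded_by {V W : normedModType R} {L : {linear V -> W}} :
  continuous L -> exists2 K : R, 0 < K & bounded_by K L.
Proof.
by move=> /linear_bounded_continuous/linear_boundedP/pinfty_ex_gt0.
Qed.

Lemma closed_kernel {V W : normedModType R} (L : V -> W) (K : R) :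
  {morph L : x y / x - y} -> bounded_by K L -> closed [set v | L v = 0].
Proof.
move=> LB LK p clp; apply: contrapT => /= /eqP; rewrite -normr_gt0 => Lp.
have K1 : 0 < `|K| + 1 by rewrite ltr_wpDl.
have e0 : 0 < `|L p| / (`|K| + 1) by rewrite divr_gt0.
have [s [/= Ls]] := clp _ (nbhsx_ballx p _ e0).
rewrite -ball_normE /ball_ /= ltr_pdivlMr// ltNge => /negP; apply.
rewrite -[L p]subr0 -Ls -LB (le_trans (LK _))// mulrC ler_wpM2l//.
by rewrite (le_trans (ler_norm _))// lerDl.
Qed.

(** The kernel of [phi] is a hyperplane unless [phi = 0]; the representing vector
    is the multiple, normalized by [phi], of a normal to it, which projection
    provides. *)
Lemma riesz_representation {V : hilbertType R} {phi : {scalar V}} {K : R} :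
  bounded_by K (phi : V -> R^o) -> exists v, forall u, phi u = '[u, v].
Proof.
move=> phiK.
have [[x phix]|phi0] := pselect (exists x, phi x != 0); last first.
  exists 0 => u; rewrite inner0r; apply/eqP; apply: contrapT => /negP nz.
  by apply: phi0; exists u.
have [||p /= p0 porth] := @orthogonal_projection _ V [set v | phi v = 0] x.
- split=> [|a y z /= y0 z0]; first by exists 0; rewrite /= linear0.
  by rewrite linearP y0 z0 mulr0 addr0.
- by apply: (@closed_kernel V R^o phi K) => // u v; rewrite linearB.
set w := x - p in porth.
have phiw : phi w = phi x by rewrite /w linearB /= p0 subr0.
have w0 : w != 0 by apply: contra_neq phix => w0; rewrite -phiw w0 linear0.
have nw : `|w| ^+ 2 != 0 by rewrite sqrf_eq0 normr_eq0.
exists ((phi w / `|w| ^+ 2) *: w) => u.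
have /porth : [set v | phi v = 0] (u - (phi u / phi w) *: w).
  by rewrite /= linearB linearZ /= divfK ?subrr// phiw.
rewrite innerBr innerZr innerxx (innerC w u) => /eqP.
rewrite subr_eq0 innerZr => /eqP ->; rewrite mulrA.
by field; rewrite normr_eq0 w0 andbT; rewrite -phiw in phix.
Qed.

Context {V W : hilbertType R} {L : {linear V -> W}}.
Hypothesis cL : continuous L.

(** [adjoint] is defined by choice, hence carries no information until some
    vector with the adjoint property exists; Riesz representation of
    [u |-> '[L u, w]] supplies it. *)
Lemma adjointP u w : '[L u, w] = '[u, adjoint L w].
Proof.
have [K K0 LK] := continuous_bounded_by cL.
pose phi u : R := '[L u, w].
have phi_lin : linear_for *%R phi.
  by move=> a x y; rewrite /phi linearP innerDl innerZl.
pose phiL : {scalar V} :=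
  HB.pack phi (GRing.isLinear.Build R V R *%R phi phi_lin).
have phiK : bounded_by (K * `|w|) (phiL : V -> R^o).
  move=> v /=; rewrite (le_trans (cauchy_schwarz _ _))// mulrAC.
  by rewrite ler_wpM2r.
by have [v vP] := riesz_representation phiK; rewrite (adjointE vP); exact: vP.
Qed.

Lemma adjointB w w' : adjoint L (w - w') = adjoint L w - adjoint L w'.
Proof. by apply: inner_inj => u; rewrite innerBr -!adjointP innerBr. Qed.

Lemma adjointD w w' : adjoint L (w + w') = adjoint L w + adjoint L w'.
Proof. by apply: inner_inj => u; rewrite innerDr -!adjointP innerDr. Qed.

Lemma adjointZ a w : adjoint L (a *: w) = a *: adjoint L w.
Proof. by apply: inner_inj => u; rewrite innerZr -!adjointP innerZr. Qed.

Lemma adjoint_bounded K : 0 < K -> bounded_by K L -> bounded_by K (adjoint L).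
Proof.
move=> K0 LK w; have [->|Lw0] := eqVneq (adjoint L w) 0.
  by rewrite normr0 mulr_ge0// ltW.
have Lw : 0 < `|adjoint L w| by rewrite normr_gt0.
rewrite -(ler_pM2l Lw) -expr2 -innerxx -adjointP (le_trans (inner_le _ _))//.
by rewrite mulrCA mulrA ler_wpM2r.
Qed.

End bounded_operators.

(** * Positive semi-definite and coercive operators *)

Section positive_operators.
Context {R : realType} {V : hilbertType R}.

(** Expand [0 <= '[v - t D v, D (v - t D v)]] at [t = K^-1]; this is the
    inequality [D^2 <= K D] between quadratic forms, obtained without taking a
    square root of [D]. *)
Lemma psd_sqr_norm_le (D : {linear V -> V}) (K : R) (v : V) :
  psd_selfadjoint D -> 0 < K -> bounded_by K D ->
  `|D v| ^+ 2 <= K * '[v, D v].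
Proof.
move=> [Dsym Dpsd] K0 DK.
have := Dpsd (v - K^-1 *: D v).
rewrite (linearB D) (linearZ_LR D) innerBl !innerBr !innerZl !innerZr.
rewrite -(Dsym v (D v)) innerxx.
have : '[D v, D (D v)] <= K * `|D v| ^+ 2.
  rewrite (le_trans (inner_le _ _))// expr2 mulrCA ler_wpM2l//.
rewrite -(ler_pM2l (_ : 0 < K^-1 ^+ 2)) ?exprn_gt0 ?invr_gt0//.
set a := '[D v, D (D v)]; set b := '[v, D v]; set c := `|D v|.
have -> : K^-1 ^+ 2 * (K * c ^+ 2) = K^-1 * c ^+ 2 by field; rewrite gt_eqF.
move=> h1 h2.
have h3 : K^-1 * c ^+ 2 <= b by lra.
by rewrite -ler_pdivrMl.
Qed.

Lemma psd_inner_le (D : {linear V -> V}) (v w : V) : psd_selfadjoint D ->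
  2 * '[D v, w] <= '[v, D v] + '[w, D w].
Proof.
move=> [Dsym Dpsd]; have := Dpsd (v - w); rewrite (linearB D) innerBl !innerBr.
by rewrite -(Dsym v w) (innerC w (D v)); lra.
Qed.

Lemma psd_polarization (D : {linear V -> V})
    (a d : V) : psd_selfadjoint D ->
  2 * '[D d, a] = '[a, D a] + '[d, D d] - '[a - d, D (a - d)].
Proof.
move=> [Dsym _]; rewrite (linearB D) innerBl !innerBr -(Dsym d a).
by rewrite (innerC a (D d)); ring.
Qed.

End positive_operators.

Section coercivity.
Context {R : realType}.

(** Rescale: a nonzero vector of [S] has a multiple of norm [r] in [S]. *)
Lemma coercive_on_lower_bound {V : hilbertType R} {W : Type} (normW : W -> R)
    (S : set V) (L : V -> W) :
  (forall a v, 0 < a -> S v -> S (a *: v)) ->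
  (forall a v, 0 < a -> normW (L (a *: v)) = a * normW (L v)) ->
  (forall w, 0 <= normW w) ->
  coercive_on Num.norm normW S L ->
  exists2 C : R, 0 < C & forall v, S v -> `|v| <= C * normW (L v).
Proof.
move=> SZ LZ L0 /(_ 1) [r Hr].
have r0 : 0 < `|r| + 1 by rewrite ltr_wpDl.
exists (`|r| + 1) => // v Sv; have [->|v0] := eqVneq v 0.
  by rewrite normr0 mulr_ge0// ltW.
have nv : 0 < `|v| by rewrite normr_gt0.
have a0 : 0 < (`|r| + 1) / `|v| by rewrite divr_gt0.
have := Hr (((`|r| + 1) / `|v|) *: v) (SZ _ _ a0 Sv).
rewrite LZ// normrZ gtr0_norm// divfK ?gt_eqF//.
rewrite (le_lt_trans (ler_norm _)) ?ltrDl// => /(_ erefl).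
by rewrite mulrAC ltr_pdivlMr// mul1r => /ltW.
Qed.

Definition bounded_below {V W : normedModType R} (L : V -> W) :=
  exists2 C : R, 0 < C & forall v, `|v| <= C * `|L v|.

Lemma coercive_bounded_below {V W : hilbertType R} (L : V -> W) :
  (forall a v, L (a *: v) = a *: L v) -> coercive L -> bounded_below L.
Proof.
move=> LZ cL.
have [//| |//|C C0 HC] := coercive_on_lower_bound _ _ _ cL.
  by move=> a v a0; rewrite LZ normrZ gtr0_norm.
by exists C => // v; exact: HC.
Qed.

End coercivity.

(** * Subgradients of convex functions *)

(** Stands for the passage to the limit [t -> 0] in inequalities that hold along a
    segment and have been divided by [t]. *)
Lemma le_of_le_small {R : realType} (a b c : R) :
  (forall t, 0 < t <= 1 -> a <= b + t * c) -> a <= b.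
Proof.
move=> h; apply/ler_addgt0Pr => e e0.
have c1 : 0 < `|c| + 1 by rewrite ltr_wpDl.
pose t := Num.min 1 (e / (`|c| + 1)).
have t0 : 0 < t by rewrite lt_min ltr01 divr_gt0.
have t1 : t <= 1 by rewrite ge_min lexx.
rewrite (le_trans (h t _)) ?t0// lerD2l.
have te : t <= e / (`|c| + 1) by rewrite ge_min lexx orbT.
have : t * (`|c| + 1) <= e by rewrite -ler_pdivlMr.
apply: le_trans; rewrite ler_wpM2l ?(ltW t0)// (le_trans (ler_norm _))//.
by rewrite lerDl.
Qed.

Lemma segmentE {R : realType} {V : hilbertType R} (x y : V) (t : R) :
  t *: y + (1 - t) *: x = x + t *: (y - x).
Proof. by rewrite scalerBl scalerBr scale1r addrCA. Qed.

Section convex_functions.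
Context {R : realType} {V : hilbertType R} {phi : V -> \bar R}.
Hypothesis phi_proper : proper_fun phi.

Lemma effdomP x : effdom phi x <-> exists a, phi x = a%:E.
Proof.
split=> [dx|[a xa]]; last by rewrite /effdom /= xa ltry.
exists (fine (phi x)); rewrite fineK// fin_numE.
by rewrite gt_eqF ?phi_proper.1//= lt_eqF.
Qed.

Lemma subdiff_effdom x v : subdiff phi x v -> effdom phi x.
Proof.
move=> xv; have [y] := phi_proper.2; rewrite /effdom /= => dy.
have := le_lt_trans (xv y) dy.
by case: (phi x) => // r _; rewrite ltry.
Qed.

Lemma subdiff_fine x v y : subdiff phi x v -> effdom phi y ->
  fine (phi x) + '[v, y - x] <= fine (phi y).
Proof.
move=> xv /effdomP[b yb]; have /effdomP[a xa] := subdiff_effdom xv.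
by have := xv y; rewrite xa yb -EFinD lee_fin.
Qed.

Lemma convex_with_fine (s : R) (x y : V) (t : R) : convex_with phi s ->
  effdom phi x -> effdom phi y -> 0 <= t <= 1 ->
  effdom phi (t *: x + (1 - t) *: y) /\
  fine (phi (t *: x + (1 - t) *: y)) + s * t * (1 - t) * `|x - y| ^+ 2
    <= t * fine (phi x) + (1 - t) * fine (phi y).
Proof.
move=> cvx dx dy t01; have := cvx x y t dx dy t01.
have /effdomP[a ->] := dx; have /effdomP[b ->] := dy; rewrite -!EFinM -EFinD.
set z := t *: x + (1 - t) *: y => h.
suff /effdomP[c zc] : effdom phi z.
  by split; [apply/effdomP; exists c|move: h; rewrite zc -EFinD lee_fin].
rewrite /effdom /=; move: h; have := phi_proper.1 z.
by case: (phi z) => //= r _ _; rewrite ltry.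
Qed.

(** Compare [phi] at [x] and at the points [t y + (1 - t) x]: the subgradient
    bounds the increment from below, convexity from above, and the quadratic
    gain survives the limit [t -> 0]. *)
Lemma subdiff_strong (s : R) (x v y : V) : convex_with phi s ->
  subdiff phi x v -> effdom phi y ->
  fine (phi x) + '[v, y - x] + s * `|y - x| ^+ 2 <= fine (phi y).
Proof.
move=> cvx xv dy; have dx := subdiff_effdom xv.
rewrite -lerBrDl; apply: (@le_of_le_small _ _ _ (s * `|y - x| ^+ 2)).
move=> t /andP[t0 t1].
have [|dz hz] := convex_with_fine cvx dy dx (t := t); first by rewrite (ltW t0).
have := subdiff_fine xv dz.
rewrite {1}segmentE (addrC x) addrK innerZr => hx; rewrite -(ler_pM2l t0).
move: hx hz; set n := `|_| ^+ 2; set i := '[_, _].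
set a := fine (phi x); set b := fine (phi y); set c := fine _; lra.
Qed.

Lemma subdiff_monotone (s : R) (x v y w : V) : convex_with phi s ->
  subdiff phi x v -> subdiff phi y w ->
  2 * s * `|x - y| ^+ 2 <= '[v - w, x - y].
Proof.
move=> cvx xv yw.
have := subdiff_strong cvx xv (subdiff_effdom yw).
have := subdiff_strong cvx yw (subdiff_effdom xv).
rewrite -(opprB x y) normrN innerNr innerBl.
by set n := `|_| ^+ 2; lra.
Qed.

Lemma subdiff_dist_le x v y w : subdiff phi x v -> subdiff phi y w ->
  `|fine (phi x) - fine (phi y)| <= (`|v| + `|w|) * `|x - y|.
Proof.
move=> xv yw.
have := subdiff_fine xv (subdiff_effdom yw).
have := subdiff_fine yw (subdiff_effdom xv).
rewrite -(opprB x y) innerNr.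
have := inner_le v (x - y); have := inner_le (- w) (x - y); rewrite innerNl normrN.
have : 0 <= `|v| * `|x - y| by rewrite mulr_ge0.
have : 0 <= `|w| * `|x - y| by rewrite mulr_ge0.
by rewrite ler_norml => *; apply/andP; split; lra.
Qed.

(** Fermat's rule for a convex function plus a quadratic one, written with the
    exact second-order expansion of the quadratic part along lines so that no
    notion of derivative is involved. *)
Lemma argmin_subdiff (q r : V -> R) (x w : V) : convex_fun phi ->
  (forall d t, q (x + t *: d) = q x + t * '[w, d] + t ^+ 2 * r d) ->
  argmin (fun z => (phi z + (q z)%:E)%E) x -> subdiff phi x (- w).
Proof.
move=> cvx qE xmin.
have dx : effdom phi x.
  have [y] := phi_proper.2; rewrite /effdom /= => dy.
  have : (phi x + (q x)%:E < +oo)%E.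
    by rewrite (le_lt_trans (xmin y))// lte_add_pinfty// ltry.
  by case: (phi x) => // b _; rewrite ltry.
move=> y; have [dy|] := pselect (effdom phi y); last first.
  by rewrite /effdom /= => /negP; rewrite ltNge leye_eq negbK => /eqP ->; rewrite leey.
have /effdomP[b yb] := dy; have /effdomP[a xa] := dx.
rewrite xa yb -EFinD lee_fin -lerBrDl.
apply: (@le_of_le_small _ _ _ (r (y - x))) => t /andP[t0 t1].
have [|dz hz] := convex_with_fine cvx dy dx (t := t); first by rewrite (ltW t0).
have := xmin (t *: y + (1 - t) *: x).
have /effdomP[c zc] := dz; rewrite zc xa -!EFinD lee_fin.
rewrite (segmentE x y t) qE => hx; rewrite -(ler_pM2l t0) innerNl.
move: hx hz; rewrite zc yb xa /= !mul0r addr0.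
by set i := '[_, _]; set qx := q x; set ry := r _; lra.
Qed.

(** One-sided difference quotients bound the derivative from below by the
    subgradient; the reverse inequality is the same bound in the direction
    [- h]. *)
Lemma subdiff_diff x v : diff_fun phi -> subdiff phi x v ->
  forall h, 'd (fine \o phi) x h = '[v, h] :> R.
Proof.
move=> phiD xv.
suff half h : '[v, h] <= 'd (fine \o phi) x h :> R.
  move=> h; apply/eqP; rewrite eq_le half andbT -lerN2 -innerNr.
  by rewrite -linearN half.
have xd := (phiD x).2; rewrite -deriveE// /derive.
have h_cvg := @diff_derivable _ _ _ _ x h xd.
have fin y : effdom phi y by rewrite /effdom /= ltey_eq (phiD y).1.
apply: (@le_trans _ _ (lim (t^-1 *: (((fine \o phi) \o shift x) (t *: h)
    - (fine \o phi) x) @[t --> 0^'+]))); last first.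
  by rewrite le_eqVlt; apply/orP; left; apply/eqP/cvg_lim => //;
    exact/cvg_dnbhs_at_right.
apply: limr_ge; first by apply/cvg_ex; eexists; exact/cvg_dnbhs_at_right/h_cvg.
near=> t; have t0 : 0 < t by [].
rewrite /= -(ler_pM2l t0) /GRing.scale /= mulrA divff ?gt_eqF// mul1r.
have := subdiff_fine xv (fin (t *: h + x)).
by rewrite addrK innerZr; lra.
Unshelve. all: by end_near. Qed.

Lemma gradient_subdiff x v : diff_fun phi -> subdiff phi x v ->
  gradient phi x = v.
Proof.
move=> phiD xv; rewrite /gradient; case: xgetP => [w _ wE|/(_ v)]; last first.
  by move=> /(_ (subdiff_diff phiD xv)).
by apply: inner_inj => h; rewrite innerC -wE (subdiff_diff phiD xv) innerC.
Qed.

Definition strongly_convex := exists2 s : R, 0 < s & convex_with phi s.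

Lemma convexity_modulus_gt0 : (0 < convexity_modulus phi)%E ->
  strongly_convex.
Proof.
by move=> /ereal_sup_gt[_ [s cvx <-]]; rewrite lte_fin; exists s.
Qed.

Lemma lipschitz_gradient_on_balls (r : R) : lipschitz_gradient_bounded phi ->
  exists2 L : R, 0 < L & forall x y, `|x| <= r -> `|y| <= r ->
    `|gradient phi x - gradient phi y| <= L * `|x - y|.
Proof.
move=> lip; have /lip/pinfty_ex_gt0[L L0 LP] : bounded_set [set x : V | `|x| <= r].
  by exists r; split; [exact: num_real|move=> s rs x /= xr; rewrite (le_trans xr)// ltW].
exists L => // x y xr yr; exact: (LP (x, y)).
Qed.

End convex_functions.

Arguments strongly_convex {R V} phi.

(** * Inequalities between real numbers *)

Lemma le_of_sqr_le {R : realType} (K n N : R) : 0 <= K -> 0 <= n -> 0 <= N ->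
  n ^+ 2 <= K * N ^+ 2 -> n <= (1 + K) * N.
Proof.
move=> K0 n0 N0 h; rewrite -(@ler_pXn2r _ 2)// ?nnegrE//; last first.
  by rewrite mulr_ge0// addr_ge0.
apply: le_trans h _; rewrite exprMn ler_wpM2r ?sqr_ge0//; nra.
Qed.

Lemma bounded_from {R : realType} (n : nat) (a : nat -> R) (r : R) :
  (forall k, a (n + k)%N <= r) -> exists r', forall k, a k <= r'.
Proof.
elim: n a r => [|n IH] a r h; first by exists r.
have [|r' hr'] := IH (fun k => a k.+1) r; first by move=> k; exact: h.
exists (Num.max (a 0%N) r') => -[|k]; rewrite le_max ?lexx// hr' orbT//.
Qed.

(** Either [s <= d], or [d < s] and the hypothesis gives [m s^2 <= 2 M d s]. *)
Lemma le_of_quadratic_le {R : realType} (m M d s : R) :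
  0 < m -> 0 <= M -> 0 <= d -> 0 <= s ->
  m * s ^+ 2 <= M * d * (d + s) -> s <= (1 + 2 * M / m) * d.
Proof.
move=> m0 M0 d0 s0 h; have q0 : 0 <= 2 * M / m.
  by rewrite divr_ge0 ?mulr_ge0// ltW.
have [sd|ds] := leP s d; first by rewrite (le_trans sd)// ler_peMl// lerDl.
have sp : 0 < s by exact: le_lt_trans ds.
suff : s <= 2 * M / m * d by move=> sh; rewrite mulrDl mul1r (le_trans sh)// lerDr.
rewrite mulrAC ler_pdivlMr// -(ler_pM2r sp).
have Md : 0 <= M * d by rewrite mulr_ge0.
nra.
Qed.

(** In the alternative, either both primal errors enter quadratically, or [a]
    is controlled by [b]; both cases reduce to one scalar quadratic inequality,
    for [a + b] and for [b] respectively. *)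
Lemma error_arithmetic {R : realType} (m K : R) : 0 < m -> 0 < K ->
  exists2 C : R, 0 < C & forall d a b l : R,
    0 <= d -> 0 <= a -> 0 <= b -> 0 <= l ->
    m * b ^+ 2 <= K * d * (a + b + l) ->
    m * a ^+ 2 <= K * d * (a + b + l) \/ a <= K * (d + b) ->
    l <= K * (d + a + b) -> a + b + l <= C * d.
Proof.
(* [T] bounds [a + b + l] by [d] and the surviving error: one factor [1 + K] comes
   from eliminating [l], the other from eliminating [a]. *)
move=> m0 K0.
have [T TE] : exists T, T = 2 * (1 + K) ^+ 2 by exists (2 * (1 + K) ^+ 2).
have [M ME] : exists M, M = 4 * K * T by exists (4 * K * T).
have T2 : 2 <= T by nra.
have TK : 2 * (1 + K) <= T by nra.
have M0 : 0 <= M by rewrite ME !mulr_ge0 ?(ltW K0)//; lra.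
exists (T * (1 + (1 + 2 * M / m))).
  have : 0 <= 2 * M / m by apply: divr_ge0; [exact: mulr_ge0|exact: ltW].
  move: (2 * M / m) => N N0; rewrite mulr_gt0//; lra.
move=> d a b l d0 a0 b0 l0 hb ha hl.
have Kd : 0 <= K * d by rewrite mulr_ge0// ltW.
suff [s [s0 hs hT]] : exists s, [/\ 0 <= s, m * s ^+ 2 <= M * d * (d + s)
    & a + b + l <= T * (d + s)].
  have := le_of_quadratic_le m0 M0 d0 s0 hs.
  move: (1 + 2 * M / m) => N hN; rewrite (le_trans hT)//.
  by rewrite -mulrA ler_wpM2l//; lra.
case: ha => ha.
  have hT : a + b + l <= T * (d + (a + b)).
    have h : a + b + l <= (1 + K) * (d + (a + b)) by lra.
    by rewrite (le_trans h)// ler_wpM2r ?addr_ge0//; lra.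
  exists (a + b); split=> //; first exact: addr_ge0.
  have h : m * (a + b) ^+ 2 <= 4 * (K * d * (a + b + l)).
    have : 0 <= m * (a - b) ^+ 2 by rewrite mulr_ge0 ?sqr_ge0// ltW.
    by move=> h; lra.
  rewrite (le_trans h)// ME.
  have := ler_wpM2l Kd hT; lra.
have hT : a + b + l <= T * (d + b).
  have h1 : a + b <= (1 + K) * (d + b) by nra.
  have h2 : a + b + l <= (1 + K) * (d + (a + b)) by lra.
  have h3 : (1 + K) * (d + (a + b)) <= (1 + K) * ((2 + K) * (d + b)).
    by rewrite ler_wpM2l//; nra.
  rewrite (le_trans h2)// (le_trans h3)// mulrA ler_wpM2r ?addr_ge0//; nra.
exists b; split=> //; rewrite (le_trans hb)// ME.
have := ler_wpM2l Kd hT.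
have : 0 <= K * d * (T * (d + b)) by rewrite mulr_ge0// mulr_ge0 ?addr_ge0//; lra.
lra.
Qed.

(** The two bounds give [e k.+1 <= M (e k - e k.+1)], a contraction by
    [M / (M + 1)]; [q] is the square root of this factor because [e] and [d]
    stand for squared quantities. *)
Lemma geometric_decay {R : realType} (e d : nat -> R) (M : R) : 1 <= M ->
  (forall k, 0 <= e k) -> (forall k, e k.+1 + d k <= e k) ->
  (forall k, e k.+1 <= M * d k) ->
  exists2 q : R, 0 < q < 1 & forall k, d k <= e 0%N * (q ^+ k) ^+ 2.
Proof.
move=> M1 e0 ed eM.
have M0 : 0 < M by lra.
have M10 : 0 < M + 1 by lra.
pose th := M / (M + 1).
have th0 : 0 < th by rewrite divr_gt0.
have th1 : th < 1 by rewrite ltr_pdivrMr// mul1r ltrDl.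
exists (Num.sqrt th).
  by rewrite sqrtr_gt0 th0 -[ltRHS]sqrtr1 ltr_sqrt.
have ek k : e k <= e 0%N * th ^+ k.
  elim: k => [|k IH]; first by rewrite mulr1.
  have h : e k.+1 <= th * e k.
    rewrite /th mulrAC ler_pdivlMr//; have := ed k; have := eM k; nra.
  by rewrite (le_trans h)// exprS mulrCA ler_wpM2l ?(ltW th0).
move=> k; rewrite -exprM mulnC exprM sqr_sqrtr ?(ltW th0)//.
by rewrite (le_trans _ (ek k))//; have := ed k; have := e0 k.+1; lra.
Qed.

Lemma sqrt_sum_sqr_le {R : realType} (a b c : R) :
  0 <= a -> 0 <= b -> 0 <= c ->
  Num.sqrt (a ^+ 2 + b ^+ 2 + c ^+ 2) <= a + b + c.
Proof.
move=> a0 b0 c0; have s0 : 0 <= a + b + c by lra.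
by rewrite -(ger0_norm s0) -sqrtr_sqr ler_wsqrtr//; nra.
Qed.

Lemma prod_norm_le {R : realType} {V W : hilbertType R} (p : V * W) :
  prod_norm p <= `|p.1| + `|p.2|.
Proof.
have := @sqrt_sum_sqr_le R `|p.1| `|p.2| 0 (normr_ge0 _) (normr_ge0 _) (lexx _).
by rewrite expr0n !addr0.
Qed.

Lemma triple_norm_le {R : realType} {X Y Z : hilbertType R} (w : X * Y * Z) :
  triple_norm w <= `|w.1.1| + `|w.1.2| + `|w.2|.
Proof.
by rewrite /triple_norm /triple_inner !innerxx; exact: sqrt_sum_sqr_le.
Qed.

(** * The iteration: optimality conditions and energy descent *)

Section proximal_admm.
Context {R : realType} {X Y Z : hilbertType R}.
Variables (rho : R) (c : Z) (A : {linear X -> Z}) (B : {linear Y -> Z})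
  (P : {linear X -> X}) (Q : {linear Y -> Y})
  (f : X -> \bar R) (g : Y -> \bar R) (u : nat -> X * Y * Z).
Hypotheses (rho_gt0 : 0 < rho) (cA : continuous A) (cB : continuous B)
  (cP : continuous P) (cQ : continuous Q)
  (P_psd : psd_selfadjoint P) (Q_psd : psd_selfadjoint Q)
  (f_proper : proper_fun f) (f_convex : convex_fun f)
  (g_proper : proper_fun g) (g_convex : convex_fun g)
  (u_admm : proximal_admm rho c A B P Q f g u).

Local Notation As := (adjoint A).
Local Notation Bs := (adjoint B).
Local Notation x k := (u k).1.1.
Local Notation y k := (u k).1.2.
Local Notation l k := (u k).2.

Lemma proximal_subproblem_optimality {V : hilbertType R} (phi : V -> \bar R)
    (L : {linear V -> Z}) (D : {linear V -> V}) (lam b : Z) (v0 v : V) :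
  proper_fun phi -> convex_fun phi -> continuous L -> psd_selfadjoint D ->
  argmin (fun z => (phi z + ('[lam, L z] + rho / 2 * `|L z + b| ^+ 2
    + 2^-1 * sqnorm_op D (z - v0))%:E)%E) v ->
  subdiff phi v (- (adjoint L (lam + rho *: (L v + b)) + D (v - v0))).
Proof.
move=> phi_proper phi_convex cL [Dsym _].
apply: (@argmin_subdiff _ _ _ phi_proper _
  (fun d => rho / 2 * `|L d| ^+ 2 + 2^-1 * '[d, D d])) => // d t.
have -> : v + t *: d - v0 = (v - v0) + t *: d by rewrite addrAC.
have -> : L (v + t *: d) + b = (L v + b) + t *: L d.
  by rewrite (linearD L) (linearZ_LR L) addrAC.
rewrite (linearD L) (linearZ_LR L) /sqnorm_op.
move: (L v + b) (v - v0) => m e; rewrite (linearD D) (linearZ_LR D) sqr_normD.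
rewrite normrZ exprMn real_normK ?num_real//.
rewrite !(innerDl, innerDr, innerZl, innerZr) (innerC (adjoint _ _)).
rewrite -adjointP// -(Dsym e d) (innerC d (D e)).
by rewrite innerDr innerZr (innerC (L d) lam) (innerC (L d) m); field.
Qed.

(** The optimality condition of the [x]-subproblem contains the multiplier
    [l k + rho (A (x k.+1) + B (y k) - c)], which differs from [l k.+1] by
    [rho B (y k.+1 - y k)]. Moving this difference to the residual makes
    [u k.+1] satisfy the KKT inclusions up to quantities that vanish with the
    step. *)
Definition x_residual k : X :=
  rho *: As (B (y k.+1 - y k)) - P (x k.+1 - x k).

Definition y_residual k : Y := - Q (y k.+1 - y k).

Lemma multiplier_step k :
  A (x k.+1) + B (y k.+1) - c = rho^-1 *: (l k.+1 - l k).
Proof.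
have := u_admm k; case: (u k) (u k.+1) => [[xk yk] lk] [[xk1 yk1] lk1] [_ _ ->] /=.
by rewrite (addrC lk) addrK scalerA mulVf ?scale1r// gt_eqF.
Qed.

Lemma x_optimality k : subdiff f (x k.+1) (x_residual k - As (l k.+1)).
Proof.
rewrite /x_residual; have := u_admm k.
case: (u k) (u k.+1) => [[xk yk] lk] [[xk1 yk1] lk1] /= [].
rewrite /x_subproblem => + _ lk1E; under eq_fun do rewrite -(addrA (A _)).
move=> xmin.
have := proximal_subproblem_optimality f_proper f_convex cA P_psd xmin.
have -> : lk + rho *: (A xk1 + (B yk - c)) = lk1 - rho *: B (yk1 - yk).
  rewrite lk1E -addrA -scalerBr; congr (_ + _ *: _).
  by rewrite linearB /= -!addrA; congr (_ + _); rewrite opprB [RHS]addrCA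
    (addrCA (B yk1)) subrr addr0 addrC.
by rewrite adjointB// adjointZ// opprD opprB addrAC.
Qed.

Lemma y_optimality k : subdiff g (y k.+1) (y_residual k - Bs (l k.+1)).
Proof.
rewrite /y_residual; have := u_admm k.
case: (u k) (u k.+1) => [[xk yk] lk] [[xk1 yk1] lk1] /= [].
rewrite /y_subproblem => _ + lk1E.
under eq_fun do rewrite (addrC (A xk1)) -(addrA (B _)).
move=> ymin.
have := proximal_subproblem_optimality g_proper g_convex cB Q_psd ymin.
by rewrite addrA (addrC (B yk1)) -lk1E opprD addrC.
Qed.

Section kkt.
Variables (ub : X * Y * Z).
Hypothesis ub_kkt : kkt_point c A B f g ub.

Local Notation xb := ub.1.1.
Local Notation yb := ub.1.2.
Local Notation lb := ub.2.

(** Add the monotonicity inequalities of the two subdifferentials: the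
    multiplier terms recombine into the feasibility residual. With the step as
    residual this yields the energy descent, and with norms it yields the error
    bound. *)
Lemma kkt_gap (sf sg : R) (v : X * Y * Z) (xi : X) (eta : Y) :
  convex_with f sf -> convex_with g sg ->
  subdiff f v.1.1 (xi - As v.2) -> subdiff g v.1.2 (eta - Bs v.2) ->
  2 * sf * `|v.1.1 - xb| ^+ 2 + 2 * sg * `|v.1.2 - yb| ^+ 2 <=
  '[xi, v.1.1 - xb] + '[eta, v.1.2 - yb]
    - '[v.2 - lb, A v.1.1 + B v.1.2 - c].
Proof.
move=> f_sf g_sg vf vg; have [bf bg bc] := ub_kkt.
have := lerD (subdiff_monotone f_proper f_sf vf bf)
  (subdiff_monotone g_proper g_sg vg bg).
have -> : A v.1.1 + B v.1.2 - c = A (v.1.1 - xb) + B (v.1.2 - yb).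
  by rewrite -bc !linearB /= opprD addrACA.
rewrite !opprK -!addrA (addrC (- As v.2)) (addrC (- Bs v.2)) -!adjointB//.
rewrite -(opprB lb); move: (lb - v.2) (_ - xb) (_ - yb) => e a b.
rewrite !innerDl innerNl innerDr (innerC (As e)) (innerC (Bs e)) -!adjointP//.
by rewrite (innerC e (A a)) (innerC e (B b)); lra.
Qed.

Lemma multiplier_step_kkt k :
  A (x k.+1 - xb) + B (y k.+1 - yb) = rho^-1 *: (l k.+1 - l k).
Proof.
have [_ _ bc] := ub_kkt; rewrite -multiplier_step -bc !linearB /=.
by rewrite opprD addrACA.
Qed.

End kkt.

(** The square of [Gnorm], with the adjoint in [Qhat] eliminated. *)
Definition G_form (w : X * Y * Z) : R :=
  '[w.1.1, P w.1.1] + rho * `|B w.1.2| ^+ 2 + '[w.1.2, Q w.1.2]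
  + rho^-1 * `|w.2| ^+ 2.

Lemma sqr_Gnorm w : Gnorm rho B P Q w ^+ 2 = G_form w.
Proof.
have GE : triple_inner w (Gop rho B P Q w) = G_form w.
  rewrite /triple_inner /Gop /Qhat /G_form /= innerDr !innerZr -adjointP//.
  by rewrite !innerxx addrA.
rewrite /Gnorm sqr_sqrtr GE// /G_form !addr_ge0//.
- exact: P_psd.2.
- by rewrite mulr_ge0 ?sqr_ge0// ltW.
- exact: Q_psd.2.
- by rewrite mulr_ge0 ?sqr_ge0// invr_ge0 ltW.
Qed.

(** The [y]-inclusion holds at both [k.+1] and [k.+2], so monotonicity of the
    subdifferential of [g] applies to consecutive iterates. This is why the
    energy contains a [Q]-term and why its descent starts at [u 1]. *)
Lemma cross_term_le k :
  2 * '[B (y k.+2 - y k.+1), l k.+2 - l k.+1] <=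
  '[y k.+1 - y k, Q (y k.+1 - y k)] - '[y k.+2 - y k.+1, Q (y k.+2 - y k.+1)].
Proof.
have := subdiff_monotone g_proper g_convex (y_optimality k.+1) (y_optimality k).
rewrite mulr0 mul0r /y_residual.
move: (y k.+2 - y k.+1) (y k.+1 - y k) => d1 d0.
have -> : - Q d1 - Bs (l k.+2) - (- Q d0 - Bs (l k.+1))
    = Q d0 - Q d1 - Bs (l k.+2 - l k.+1).
  rewrite adjointB// !opprB opprK [LHS]addrC (addrC (Bs (l k.+1))).
  exact: addrACA.
move: (l k.+2 - l k.+1) => e.
rewrite !innerBl (innerC (Bs e)) -adjointP// (innerC (Q d1)).
by have := psd_inner_le d0 d1 Q_psd; lra.
Qed.

(** Indexed so that [energy ub k] belongs to the iterate [u k.+1], the first one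
    that has a predecessor. *)
Definition energy (ub : X * Y * Z) k : R :=
  G_form (u k.+1 - ub) + '[y k.+1 - y k, Q (y k.+1 - y k)].

(** By polarization [kkt_gap] becomes a telescoping difference of [G_form] plus
    the term [2 '[B dy, dl]] created by the alternating updates, which
    [cross_term_le] telescopes as well. *)
Lemma energy_descent (ub : X * Y * Z) (sf sg : R) k :
  kkt_point c A B f g ub -> convex_with f sf -> convex_with g sg ->
  energy ub k.+1 + G_form (u k.+2 - u k.+1)
    + 4 * sf * `|x k.+2 - ub.1.1| ^+ 2 + 4 * sg * `|y k.+2 - ub.1.2| ^+ 2
  <= energy ub k.
Proof.
move=> ub_kkt f_sf g_sg.
have := kkt_gap ub_kkt f_sf g_sg (x_optimality k.+1) (y_optimality k.+1).
have := cross_term_le k; rewrite /energy /G_form /=.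
have Ax := multiplier_step_kkt ub_kkt k.+1.
rewrite multiplier_step /x_residual /y_residual.
(* Every difference is expressed through the new error and the step, the two
   arguments of [psd_polarization]. *)
have dE (V : zmodType) (a b d : V) : a - b = (d - b) - (d - a).
  by rewrite opprB [RHS]addrC addrA subrK.
have dx : x k.+1 - ub.1.1 = (x k.+2 - ub.1.1) - (x k.+2 - x k.+1) by exact: dE.
have dy : y k.+1 - ub.1.2 = (y k.+2 - ub.1.2) - (y k.+2 - y k.+1) by exact: dE.
have dl : l k.+1 - ub.2 = (l k.+2 - ub.2) - (l k.+2 - l k.+1) by exact: dE.
rewrite dx dy dl {dx dy dl}; move: Ax.
move: (x k.+2 - ub.1.1) (y k.+2 - ub.1.2) (l k.+2 - ub.2) => a b e.
move: (x k.+2 - x k.+1) (y k.+2 - y k.+1) (l k.+2 - l k.+1) => da db de.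
move: (y k.+1 - y k) => db' Ax hc hk.
have hP := psd_polarization a da P_psd; have hQ := psd_polarization b db Q_psd.
move: hk; rewrite [in '[_ - _, a]]innerBl innerZl innerNl innerZr.
rewrite (innerC (As _)) -adjointP// -(addrK (B b) (A a)) Ax.
rewrite (innerBl (_ *: de)) innerZl (innerC de).
have -> : rho * (rho^-1 * '[B db, de] - '[B b, B db])
    = '[B db, de] - rho * '[B b, B db] by field; rewrite gt_eqF.
rewrite (linearB B b) (sqr_normB (B b)) (sqr_normB e).
lra.
Qed.

(** * Bounds by the step length *)

Lemma G_form_ge0 w : 0 <= G_form w.
Proof. by rewrite -sqr_Gnorm sqr_ge0. Qed.

Lemma G_form_terms_le w :
  [/\ '[w.1.1, P w.1.1] <= G_form w, rho * `|B w.1.2| ^+ 2 <= G_form w,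
      '[w.1.2, Q w.1.2] <= G_form w & rho^-1 * `|w.2| ^+ 2 <= G_form w].
Proof.
have := P_psd.2 w.1.1; have := Q_psd.2 w.1.2.
have : 0 <= rho * `|B w.1.2| ^+ 2 by rewrite mulr_ge0 ?sqr_ge0// ltW.
have : 0 <= rho^-1 * `|w.2| ^+ 2 by rewrite mulr_ge0 ?sqr_ge0// invr_ge0 ltW.
by rewrite /G_form => *; split; lra.
Qed.

Lemma Gnorm_ge0 w : 0 <= Gnorm rho B P Q w.
Proof. exact: sqrtr_ge0. Qed.

(** The seminorm need not control [w.1.1] or [w.1.2], but it controls their
    images under the operators that enter the residuals, through
    [psd_sqr_norm_le]. *)
Lemma Gnorm_terms_le : exists2 K : R, 0 < K & forall w,
  [/\ `|P w.1.1| <= K * Gnorm rho B P Q w, `|B w.1.2| <= K * Gnorm rho B P Q w,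
      `|Q w.1.2| <= K * Gnorm rho B P Q w & `|w.2| <= K * Gnorm rho B P Q w].
Proof.
have [KP KP0 PK] := continuous_bounded_by cP.
have [KQ KQ0 QK] := continuous_bounded_by cQ.
have ir0 : 0 < rho^-1 by rewrite invr_gt0.
exists (1 + (KP + KQ + rho + rho^-1)); first by rewrite ltr_wpDr// !addr_ge0// ltW.
move=> w; have [Pw Bw Qw lw] := G_form_terms_le w.
have [K KE] : exists K : R, K = KP + KQ + rho + rho^-1 by eexists.
have r0 := rho_gt0.
have [leP leQ] : KP <= K /\ KQ <= K by split; lra.
have [ler leir] : rho <= K /\ rho^-1 <= K by split; lra.
have K0 : 0 <= K by lra.
have G0 := G_form_ge0 w.
rewrite -KE; split; apply: le_of_sqr_le => //; try exact: Gnorm_ge0;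
  rewrite sqr_Gnorm.
- rewrite (le_trans (psd_sqr_norm_le _ P_psd KP0 PK))//.
  by rewrite (@le_trans _ _ (KP * G_form w)) ?ler_wpM2l ?ler_wpM2r ?(ltW KP0).
- rewrite (@le_trans _ _ (rho^-1 * G_form w)) ?ler_wpM2r//.
  by rewrite ler_pdivlMl.
- rewrite (le_trans (psd_sqr_norm_le _ Q_psd KQ0 QK))//.
  by rewrite (@le_trans _ _ (KQ * G_form w)) ?ler_wpM2l ?ler_wpM2r ?(ltW KQ0).
- rewrite (@le_trans _ _ (rho * G_form w)) ?ler_wpM2r//.
  by rewrite -ler_pdivrMl.
Qed.

Lemma G_form_le : exists2 K : R, 0 < K & forall w,
  G_form w <= K * (`|w.1.1| + `|w.1.2| + `|w.2|) ^+ 2.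
Proof.
have [KP KP0 PK] := continuous_bounded_by cP.
have [KQ KQ0 QK] := continuous_bounded_by cQ.
have [KB KB0 BK] := continuous_bounded_by cB.
have ir0 : 0 < rho^-1 by rewrite invr_gt0.
have rB0 : 0 < rho * KB ^+ 2 by rewrite mulr_gt0// exprn_gt0.
exists (KP + rho * KB ^+ 2 + KQ + rho^-1); first by rewrite !addr_gt0.
move=> w; rewrite /G_form.
have form_le (V : hilbertType R) (D : V -> V) K v : bounded_by K D ->
    '[v, D v] <= K * `|v| ^+ 2.
  by move=> DK; rewrite (le_trans (inner_le _ _))// expr2 mulrCA ler_wpM2l.
have := form_le _ _ _ w.1.1 PK; have := form_le _ _ _ w.1.2 QK.
have : rho * `|B w.1.2| ^+ 2 <= rho * KB ^+ 2 * `|w.1.2| ^+ 2.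
  rewrite -mulrA ler_wpM2l ?(ltW rho_gt0)// -exprMn.
  by rewrite ler_pXn2r ?nnegrE// mulr_ge0// ltW.
set s := _ + _ + `|w.2|.
have sq_le (t : R) : 0 <= t -> t <= s -> t ^+ 2 <= s ^+ 2.
  by move=> t0 ts; rewrite ler_pXn2r ?nnegrE// (le_trans t0).
have n1 := normr_ge0 w.1.1; have n2 := normr_ge0 w.1.2; have n3 := normr_ge0 w.2.
have a1 := ler_wpM2l (ltW KP0) (sq_le _ n1 (_ : _ <= s)).
have a2 := ler_wpM2l (ltW rB0) (sq_le _ n2 (_ : _ <= s)).
have a3 := ler_wpM2l (ltW KQ0) (sq_le _ n2 (_ : _ <= s)).
have a4 := ler_wpM2l (ltW ir0) (sq_le _ n3 (_ : _ <= s)).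
have s1 : `|w.1.1| <= s by rewrite /s; lra.
have s2 : `|w.1.2| <= s by rewrite /s; lra.
have s3 : `|w.2| <= s by rewrite /s; lra.
have := a1 s1; have := a2 s2; have := a3 s2; have := a4 s3.
by move=> *; lra.
Qed.

Local Notation delta k := (Gnorm rho B P Q (u k.+1 - u k)).

Lemma residuals_le : exists2 K : R, 0 < K & forall k,
  [/\ `|x_residual k| <= K * delta k, `|y_residual k| <= K * delta k
    & `|l k.+1 - l k| <= K * delta k].
Proof.
have [K K0 GK] := Gnorm_terms_le.
have [KA KA0 /(adjoint_bounded cA KA0) AK] := continuous_bounded_by cA.
exists (rho * KA * K + K); first by rewrite addr_gt0 ?mulr_gt0.
move=> k; have [/= Pw Bw Qw lw] := GK (u k.+1 - u k).
have d0 := Gnorm_ge0 (u k.+1 - u k).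
have KKd : 0 <= rho * KA * K * delta k.
  by rewrite mulr_ge0// ltW// !mulr_gt0.
have w : forall t : R, t <= K * delta k -> t <= (rho * KA * K + K) * delta k.
  by move=> t tK; rewrite mulrDl; lra.
split; [|by rewrite /y_residual normrN; exact: w|exact: w].
rewrite /x_residual (le_trans (ler_normB _ _))// mulrDl lerD//.
rewrite normrZ gtr0_norm// -!mulrA ler_wpM2l ?(ltW rho_gt0)//.
by rewrite (le_trans (AK _))// ler_wpM2l// ltW.
Qed.

(** * Error bound and linear rate *)

Section rate.
Variable (ub : X * Y * Z).
Hypotheses (ub_kkt : kkt_point c A B f g ub)
  (fA : strongly_convex f \/ bounded_below A) (g_strong : strongly_convex g).

Local Notation xb := ub.1.1.
Local Notation yb := ub.1.2.
Local Notation lb := ub.2.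

(** Feasibility of [ub] expresses [A (x k.+1 - xb)] through the multiplier step
    and [B (y k.+1 - yb)]. *)
Lemma x_error_le_of_bounded_below : bounded_below A ->
  exists2 K : R, 0 < K & forall k,
    `|x k.+1 - xb| <= K * (delta k + `|y k.+1 - yb|).
Proof.
move=> [CA CA0 AC]; have [K K0 rK] := residuals_le.
have [KB KB0 BK] := continuous_bounded_by cB.
have ir0 : 0 < rho^-1 by rewrite invr_gt0.
exists (CA * (rho^-1 * K + KB)); first by rewrite mulr_gt0 ?addr_gt0 ?mulr_gt0.
move=> k; rewrite (le_trans (AC _))// -mulrA ler_wpM2l ?(ltW CA0)//.
have [_ _ lK] := rK k; have := multiplier_step_kkt ub_kkt k.
move=> /eqP; rewrite -subr_eq0 -addrA addr_eq0 opprB => /eqP ->.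
rewrite (le_trans (ler_normB _ _))// normrZ gtr0_norm//.
have := ler_wpM2l (ltW ir0) lK; have := BK (y k.+1 - yb).
have := Gnorm_ge0 (u k.+1 - u k); have := normr_ge0 (y k.+1 - yb).
have : 0 < rho^-1 * K by rewrite mulr_gt0.
move: (delta k) (`|y k.+1 - yb|) (`|B _|) (`|l k.+1 - l k|) (rho^-1).
move=> d b Bb e ir; nra.
Qed.

Lemma energy_ge0 k : 0 <= energy ub k.
Proof. by rewrite addr_ge0 ?G_form_ge0 ?Q_psd.2. Qed.

Lemma energy_step k :
  energy ub k.+1 + delta k.+1 ^+ 2 <= energy ub k.
Proof.
by have := energy_descent k ub_kkt f_convex g_convex; rewrite sqr_Gnorm; lra.
Qed.

Lemma energy_le0 k : energy ub k <= energy ub 0%N.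
Proof.
elim: k => // k IH; have := energy_step k; have := sqr_ge0 (delta k.+1).
by lra.
Qed.

Lemma steps_bounded : exists r, forall k, delta k <= r.
Proof.
apply: (@bounded_from _ 1 (fun k => delta k) (1 + energy ub 0%N)) => k.
rewrite -[leRHS]mulr1; apply: le_of_sqr_le; rewrite ?energy_ge0 ?Gnorm_ge0//.
rewrite expr1n mulr1; have := energy_step k; have := energy_le0 k.
by have := energy_ge0 k.+1; rewrite add1n; lra.
Qed.

Lemma strong_bounded (a : nat -> R) (s : R) : 0 < s -> (forall k, 0 <= a k) ->
  (forall k, 4 * s * a k.+2 ^+ 2 <= energy ub 0%N) ->
  exists r, forall k, a k <= r.
Proof.
move=> s0 a0 ha.
apply: (@bounded_from _ 2 a (1 + energy ub 0%N / (4 * s))) => k.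
have s4 : 0 < 4 * s by rewrite mulr_gt0.
rewrite -[leRHS]mulr1; apply: le_of_sqr_le; rewrite ?divr_ge0 ?energy_ge0 ?(ltW s4)//.
by rewrite expr1n mulr1 ler_pdivlMr// mulrC add2n.
Qed.

Lemma y_errors_bounded : exists r, forall k, `|y k - yb| <= r.
Proof.
have [s s0 g_s] := g_strong.
apply: (strong_bounded s0) => // k.
have := energy_descent k ub_kkt f_convex g_s.
have := energy_le0 k; have := energy_ge0 k.+1; have := G_form_ge0 (u k.+2 - u k.+1).
by move=> *; lra.
Qed.

Lemma x_errors_bounded : exists r, forall k, `|x k - xb| <= r.
Proof.
case: fA => [[s s0 f_s]|/x_error_le_of_bounded_below[K K0 xK]].
  apply: (strong_bounded s0) => // k.
  have := energy_descent k ub_kkt f_s g_convex.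
  have := energy_le0 k; have := energy_ge0 k.+1; have := G_form_ge0 (u k.+2 - u k.+1).
  by move=> *; lra.
have [d hd] := steps_bounded; have [r hr] := y_errors_bounded.
apply: (@bounded_from _ 1 _ (K * (d + r))) => k; rewrite add1n.
by rewrite (le_trans (xK _))// ler_wpM2l ?(ltW K0)// lerD.
Qed.

(** The part of the error bound whose proof depends on which of the four
    conditions holds. *)
Definition multiplier_controlled := exists2 K : R, 0 < K & forall k,
  `|l k.+1 - lb| <= K * (delta k + `|x k.+1 - xb| + `|y k.+1 - yb|).

Hypothesis l_ctrl : multiplier_controlled.

Local Notation err k := (`|x k - xb| + `|y k - yb| + `|l k - lb|).

(** In [kkt_gap] the left-hand side is quadratic in the primal errors while the
    right-hand side is the step length times the total error; substituting the
    multiplier error leaves a quadratic inequality that forces all errors to be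
    of the order of the step. *)
Lemma error_bound : exists2 C : R, 0 < C & forall k, err k.+1 <= C * delta k.
Proof.
have [K1 K10 rK] := residuals_le; have [K2 K20 lK] := l_ctrl.
have [sg sg0 g_s] := g_strong.
have ir0 : 0 < rho^-1 by rewrite invr_gt0.
have gap sf k : convex_with f sf ->
    2 * sf * `|x k.+1 - xb| ^+ 2 + 2 * sg * `|y k.+1 - yb| ^+ 2
    <= (K1 + rho^-1 * K1) * delta k * err k.+1.
  move=> f_s; have := kkt_gap ub_kkt f_s g_s (x_optimality k) (y_optimality k).
  rewrite multiplier_step => /le_trans; apply.
  have [xi eta dl] := rK k.
  have i1 := le_trans (inner_le (x_residual k) (x k.+1 - xb))
    (ler_wpM2r (normr_ge0 _) xi).
  have i2 := le_trans (inner_le (y_residual k) (y k.+1 - yb))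
    (ler_wpM2r (normr_ge0 _) eta).
  have i3 := le_trans (inner_le (- (l k.+1 - l k)) (l k.+1 - lb))
    (ler_wpM2r (normr_ge0 _) (_ : _ <= K1 * delta k)).
  rewrite normrN in i3; have {}i3 := ler_wpM2l (ltW ir0) (i3 dl).
  rewrite innerZr (innerC (l k.+1 - lb)); rewrite innerNl in i3.
  have d0 := Gnorm_ge0 (u k.+1 - u k).
  have Kd : 0 <= K1 * delta k by rewrite mulr_ge0// ltW.
  have Kd' : 0 <= rho^-1 * (K1 * delta k) by rewrite mulr_ge0// ltW.
  have j1 := mulr_ge0 Kd (normr_ge0 (l k.+1 - lb)).
  have j2 := mulr_ge0 Kd' (normr_ge0 (x k.+1 - xb)).
  have j3 := mulr_ge0 Kd' (normr_ge0 (y k.+1 - yb)).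
  lra.
have K10' : 0 < K1 + rho^-1 * K1 by rewrite addr_gt0 ?mulr_gt0.
case: fA => [[sf sf0 f_s]|/x_error_le_of_bounded_below[K3 K30 xK]].
- pose m := Num.min (2 * sf) (2 * sg); pose K := K1 + rho^-1 * K1 + K2.
  have m0 : 0 < m by rewrite lt_min !mulr_gt0.
  have K0 : 0 < K by rewrite addr_gt0.
  have [C C0 HC] := error_arithmetic m0 K0.
  exists C => // k; have d0 := Gnorm_ge0 (u k.+1 - u k).
  have e0 : 0 <= err k.+1 by rewrite !addr_ge0.
  have hK : (K1 + rho^-1 * K1) * delta k * err k.+1 <= K * delta k * err k.+1.
    by rewrite !ler_wpM2r// lerDl ltW.
  have mf : m * `|x k.+1 - xb| ^+ 2 <= 2 * sf * `|x k.+1 - xb| ^+ 2.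
    by rewrite ler_wpM2r ?sqr_ge0// ge_min lexx.
  have mg : m * `|y k.+1 - yb| ^+ 2 <= 2 * sg * `|y k.+1 - yb| ^+ 2.
    by rewrite ler_wpM2r ?sqr_ge0// ge_min lexx orbT.
  have mf0 : 0 <= 2 * sf * `|x k.+1 - xb| ^+ 2.
    by rewrite mulr_ge0 ?sqr_ge0// mulr_ge0// ltW.
  have mg0 : 0 <= 2 * sg * `|y k.+1 - yb| ^+ 2.
    by rewrite mulr_ge0 ?sqr_ge0// mulr_ge0// ltW.
  have := gap _ k f_s => hg; apply: HC => //; [lra|left; lra|].
  rewrite (le_trans (lK _))// ler_wpM2r ?addr_ge0// /K.
  by rewrite lerDr ltW.
- pose K := K1 + rho^-1 * K1 + K2 + K3.
  have m0 : 0 < 2 * sg by rewrite mulr_gt0.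
  have K0 : 0 < K by rewrite !addr_gt0 ?mulr_gt0.
  have [C C0 HC] := error_arithmetic m0 K0.
  exists C => // k; have d0 := Gnorm_ge0 (u k.+1 - u k).
  have e0 : 0 <= err k.+1 by rewrite !addr_ge0.
  have hK : (K1 + rho^-1 * K1) * delta k * err k.+1 <= K * delta k * err k.+1.
    by rewrite !ler_wpM2r// /K -addrA lerDl addr_ge0 ?ltW.
  apply: HC => //.
  + by have := gap _ k f_convex; rewrite mulr0 mul0r add0r => /le_trans; apply.
  + right; rewrite (le_trans (xK _))// ler_wpM2r ?addr_ge0//.
    by rewrite /K lerDr ltW// !addr_gt0 ?mulr_gt0.
  + rewrite (le_trans (lK _))// ler_wpM2r ?addr_ge0// /K.
    by rewrite -addrA addrCA lerDl ltW// !addr_gt0 ?mulr_gt0.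
Qed.

Lemma linear_rate : exists C q : R, [/\ 0 < C, 0 < q < 1 &
  forall k, (1 <= k)%N -> err k <= C * q ^+ k].
Proof.
have [C C0 eC] := error_bound; have [KG KG0 GK] := G_form_le.
pose M := KG * C ^+ 2 + 1.
have M1 : 1 <= M by rewrite lerDr mulr_ge0 ?sqr_ge0// ltW.
have [|q /andP[q0 q1] dq] := @geometric_decay _ (energy ub)
    (fun k => delta k.+1 ^+ 2) M M1 energy_ge0 energy_step.
  move=> k; rewrite /M mulrDl mul1r lerD//.
    rewrite (le_trans (GK _))// -mulrA ler_wpM2l ?(ltW KG0)// -exprMn.
    by rewrite ler_pXn2r ?nnegrE ?mulr_ge0 ?Gnorm_ge0 ?addr_ge0 ?(ltW C0)//; exact: eC.
  by rewrite sqr_Gnorm; have [] := G_form_terms_le (u k.+2 - u k.+1).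
pose E := 1 + energy ub 0%N.
have E0 : 0 < E by rewrite ltr_wpDr ?energy_ge0.
have dE k : delta k.+1 <= E * q ^+ k.
  by apply: le_of_sqr_le; rewrite ?energy_ge0 ?Gnorm_ge0 ?exprn_ge0 ?(ltW q0).
(* The step [delta k.+1] bounds the error at [k.+2], hence the division by
   [q ^+ 2]; the error at [1], which no decaying step bounds, enters the constant
   directly. *)
exists (err 1%N / q + C * E / q ^+ 2), q; rewrite q0 q1; split => //.
  rewrite ltr_wpDl ?divr_gt0 ?mulr_gt0 ?exprn_gt0//.
  by rewrite divr_ge0 ?addr_ge0// ltW.
have D0 : 0 <= C * E / q ^+ 2 by rewrite ltW// divr_gt0 ?mulr_gt0 ?exprn_gt0.
have D1 : 0 <= err 1%N / q by rewrite divr_ge0 ?addr_ge0// ltW.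
move=> [//|[|k]] _.
  by rewrite expr1 mulrDl divfK ?gt_eqF// lerDl mulr_ge0// ltW.
rewrite (le_trans (eC _))// mulrDl.
have -> : C * E / q ^+ 2 * q ^+ k.+2 = C * (E * q ^+ k).
  by rewrite -[k.+2]add2n exprD; field; rewrite gt_eqF.
rewrite -[leLHS]add0r lerD//; first by rewrite mulr_ge0 ?exprn_ge0// ltW.
by rewrite ler_wpM2l ?(ltW C0).
Qed.

End rate.

(** * Control of the multipliers under the four conditions *)

(** For differentiable [phi] the inclusions are equations: the adjoint of [L]
    applied to the multiplier error is a difference of gradients, up to the
    residual. Boundedness of the iterates makes the local Lipschitz constant
    uniform. *)
Lemma dual_error_le {V : hilbertType R} {phi : V -> \bar R}
    {L : {linear V -> Z}} {v xi : nat -> V} {vb : V} {lb : Z} {r K : R} :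
  proper_fun phi -> diff_fun phi -> lipschitz_gradient_bounded phi ->
  continuous L -> (forall k, `|v k - vb| <= r) ->
  (forall k, subdiff phi (v k.+1) (xi k - adjoint L (l k.+1))) ->
  subdiff phi vb (- adjoint L lb) -> (forall k, `|xi k| <= K * delta k) ->
  0 < K ->
  exists2 K' : R, 0 < K' & forall k,
    `|adjoint L (l k.+1 - lb)| <= K' * (delta k + `|v k.+1 - vb|).
Proof.
move=> phi_proper phiD philip cL vr vphi vbphi xiK K0.
have [C C0 gradC] := lipschitz_gradient_on_balls (r + `|vb|) philip.
exists (K + C); first exact: addr_gt0.
move=> k; have vb_in : `|vb| <= r + `|vb|.
  by rewrite lerDr (le_trans _ (vr 0%N)).
have v_in : `|v k.+1| <= r + `|vb|.
  by rewrite -[v _](subrK vb) (le_trans (ler_normD _ _))// lerD.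
have := gradC _ _ v_in vb_in.
rewrite (gradient_subdiff phi_proper phiD (vphi k)).
rewrite (gradient_subdiff phi_proper phiD vbphi) opprK -addrA => grad_le.
have -> : adjoint L (l k.+1 - lb)
    = xi k - (xi k + (- adjoint L (l k.+1) + adjoint L lb)).
  by rewrite opprD addrA subrr sub0r opprD opprK adjointB.
rewrite (le_trans (ler_normB _ _))// (le_trans (lerD (xiK k) grad_le))//.
have d0 := Gnorm_ge0 (u k.+1 - u k).
rewrite mulrDr !mulrDl lerD// ?lerDl ?lerDr mulr_ge0//; exact: ltW.
Qed.

Lemma bounded_below_multiplier_controlled ub :
  kkt_point c A B f g ub -> strongly_convex g -> bounded_below Bs ->
  diff_fun g -> lipschitz_gradient_bounded g -> multiplier_controlled ub.
Proof.
move=> ub_kkt g_strong [C C0 BC] gD glip; have [bf bg bc] := ub_kkt.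
have [K K0 rK] := residuals_le; have [r yr] := y_errors_bounded ub_kkt g_strong.
have [|K' K'0 HK] := dual_error_le g_proper gD glip cB yr y_optimality bg _ K0.
  by move=> k; have [] := rK k.
exists (C * K'); first exact: mulr_gt0.
move=> k; rewrite (le_trans (BC _))// -mulrA ler_wpM2l ?(ltW C0)//.
rewrite (le_trans (HK _))// ler_wpM2l ?(ltW K'0)//.
by rewrite addrAC lerDl.
Qed.

(** Since [c = A xb + B yb], every multiplier update lies in the range of
    [(x, y) |-> A x + B y]; starting from [0] the multipliers never leave the
    orthogonal complement of the kernel of [Mstar]. *)
Lemma multiplier_in_ker_perp k (ub : X * Y * Z) :
  kkt_point c A B f g ub -> (u 0%N).2 = 0 -> Mstar_ker_perp A B (l k).
Proof.
move=> [_ _ bc] l0 w [Aw Bw]; elim: k => [|k IH]; first by rewrite l0 inner0r.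
have -> : l k.+1 = l k + rho *: (A (x k.+1) + B (y k.+1) - c).
  by rewrite multiplier_step scalerA mulfV ?gt_eqF// scale1r addrC subrK.
rewrite -bc opprD addrACA -(linearB A) -(linearB B) innerDr IH add0r innerZr.
rewrite innerDr !(innerC w) !adjointP// Aw Bw !inner0r addr0 mulr0 //.
Qed.

(** The KKT conditions see a multiplier only through [Mstar], so its component
    in the kernel of [Mstar] can be removed by projection. *)
Lemma kkt_point_ker_perp (ub : X * Y * Z) : kkt_point c A B f g ub ->
  exists2 vb, kkt_point c A B f g vb & Mstar_ker_perp A B vb.2.
Proof.
case: ub => [[xb yb] lb] [/= bf bg bc].
have [KA KA0 /(adjoint_bounded cA KA0) AK] := continuous_bounded_by cA.
have [KB KB0 /(adjoint_bounded cB KB0) BK] := continuous_bounded_by cB.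
pose N : set Z := [set w | As w = 0] `&` [set w | Bs w = 0].
have [||p [/= Ap Bp] porth] := @orthogonal_projection _ _ N lb.
- split=> [|a v w [/= Av Bv] [/= Aw Bw]].
    by exists 0; split => /=; rewrite -(subrr 0) adjointB// subrr.
  by split => /=; rewrite adjointD// adjointZ// ?Av ?Bv ?Aw ?Bw scaler0 addr0.
- apply: closedI.
  + by apply: closed_kernel AK => v w; exact: adjointB.
  + by apply: closed_kernel BK => v w; exact: adjointB.
exists (xb, yb, lb - p); last first.
  by move=> w [Aw Bw] /=; rewrite innerC; apply: porth.
by split; rewrite //= adjointB// ?Ap ?Bp subr0.
Qed.

Lemma ker_perp_multiplier_controlled ub :
  kkt_point c A B f g ub -> Mstar_ker_perp A B ub.2 -> (u 0%N).2 = 0 ->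
  strongly_convex f \/ bounded_below A -> strongly_convex g ->
  Mstar_coercive A B -> diff_fun f -> lipschitz_gradient_bounded f ->
  diff_fun g -> lipschitz_gradient_bounded g -> multiplier_controlled ub.
Proof.
move=> ub_kkt ub_perp l0 fA g_strong Mco fD flip gD glip.
have [bf bg bc] := ub_kkt; have [K K0 rK] := residuals_le.
have [ry yr] := y_errors_bounded ub_kkt g_strong.
have [rx xr] := x_errors_bounded ub_kkt fA g_strong.
have [|K1 K10 HA] := dual_error_le f_proper fD flip cA xr x_optimality bf _ K0.
  by move=> k; have [] := rK k.
have [|K2 K20 HB] := dual_error_le g_proper gD glip cB yr y_optimality bg _ K0.
  by move=> k; have [] := rK k.
have [|||C C0 HC] := coercive_on_lower_bound _ _ _ Mco.
- by move=> a v a0 Sv w Mw; rewrite innerZr Sv// mulr0.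
- move=> a v a0; rewrite /prod_norm /= !adjointZ// !normrZ !exprMn -mulrDr.
  by rewrite sqrtrM ?sqr_ge0// sqrtr_sqr normr_id gtr0_norm.
- by move=> w; exact: sqrtr_ge0.
exists (C * (K1 + K2)); first by rewrite mulr_gt0// addr_gt0.
move=> k; have perp : Mstar_ker_perp A B (l k.+1 - ub.2).
  move=> w Mw; rewrite innerBr (multiplier_in_ker_perp _ ub_kkt l0 Mw).
  by rewrite ub_perp// subr0.
rewrite (le_trans (HC _ perp))// -mulrA ler_wpM2l ?(ltW C0)//.
have d0 := Gnorm_ge0 (u k.+1 - u k).
have := HA k; have := HB k; have := normr_ge0 (x k.+1 - ub.1.1).
have := normr_ge0 (y k.+1 - ub.1.2).
have := prod_norm_le (Mstar A B (l k.+1 - ub.2)); rewrite /=.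
move: (prod_norm _) (`|As _|) (`|Bs _|) (`|x k.+1 - _|) (`|y k.+1 - _|).
move: (delta k) d0 => d d0 n a b ex ey h1 ey0 ex0 h2 h3.
have K2x : 0 <= K2 * ex by rewrite mulr_ge0// ltW.
have K1y : 0 <= K1 * ey by rewrite mulr_ge0// ltW.
by lra.
Qed.

(** * Objective values and conclusion *)

Lemma min_value_kkt ub : kkt_point c A B f g ub ->
  min_value c A B f g = (fine (f ub.1.1) + fine (g ub.1.2))%:E.
Proof.
move=> [bf bg bc]; apply/eqP; rewrite eq_le; apply/andP; split.
  have /(effdomP f_proper)[a fa] := subdiff_effdom f_proper bf.
  have /(effdomP g_proper)[b gb] := subdiff_effdom g_proper bg.
  rewrite fa gb /= EFinD -fa -gb; apply: ereal_inf_lbound.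
  by exists ub.1.
apply: le_ereal_inf_tmp => _ [[v w] /= vw <-]; rewrite /objective.
have := leeD (bf v) (bg w).
have /(effdomP f_proper)[a ->] := subdiff_effdom f_proper bf.
have /(effdomP g_proper)[b ->] := subdiff_effdom g_proper bg.
rewrite -!EFinD /=; apply: le_trans; rewrite lee_fin.
rewrite !innerNl !(innerC (adjoint _ _)) -!adjointP//.
have : '[A (v - ub.1.1), ub.2] + '[B (w - ub.1.2), ub.2] = 0 :> R.
  by rewrite -innerDl !linearB addrACA -opprD vw bc subrr inner0l.
by move: '[_, _] '[_, _] => s t st; lra.
Qed.

(** Subgradients at [u k.+1] and at [ub] bound the difference of objective values
    from both sides; they are uniformly bounded along the iteration. *)
Lemma objective_error_le ub : kkt_point c A B f g ub ->
  (exists r, forall k, `|x k - ub.1.1| + `|y k - ub.1.2| + `|l k - ub.2| <= r) ->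
  exists2 K : R, 0 < K & forall k,
    (`|objective f g (x k.+1) (y k.+1) - min_value c A B f g|
      <= (K * (`|x k.+1 - ub.1.1| + `|y k.+1 - ub.1.2|))%:E)%E.
Proof.
move=> ub_kkt [r hr]; have [bf bg bc] := ub_kkt.
have [K K0 rK] := residuals_le; have [d hd] := steps_bounded ub_kkt.
have [KA KA0 /(adjoint_bounded cA KA0) AK] := continuous_bounded_by cA.
have [KB KB0 /(adjoint_bounded cB KB0) BK] := continuous_bounded_by cB.
have r0 : 0 <= r by rewrite (le_trans _ (hr 0%N))// !addr_ge0.
have d0 : 0 <= d by rewrite (le_trans _ (hd 0%N))// Gnorm_ge0.
pose S KL := K * d + KL * (r + `|ub.2|) + KL * `|ub.2|.
have S0 KL : 0 < KL -> 0 <= S KL.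
  by move=> KL0; rewrite /S !addr_ge0// mulr_ge0// ?addr_ge0// ltW.
have subgrad_le (V : hilbertType R) (L : {linear V -> Z}) KL (e : V) k :
    0 < KL -> bounded_by KL (adjoint L) -> `|e| <= K * delta k ->
    `|e - adjoint L (l k.+1)| + `|- adjoint L ub.2| <= S KL.
  move=> KL0 LK he; rewrite normrN lerD//.
  rewrite (le_trans (ler_normB _ _))// lerD//.
    by rewrite (le_trans he)// ler_wpM2l ?(ltW K0).
  rewrite (le_trans (LK _))// ler_wpM2l ?(ltW KL0)//.
  rewrite -[l _](subrK ub.2) (le_trans (ler_normD _ _))// lerD2r.
  by rewrite (le_trans _ (hr k.+1))// lerDr addr_ge0.
exists (S KA + S KB + 1); first by rewrite ltr_wpDl// addr_ge0 ?S0.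
move=> k; rewrite (min_value_kkt ub_kkt) /objective.
have fk := subdiff_dist_le f_proper (x_optimality k) bf.
have gk := subdiff_dist_le g_proper (y_optimality k) bg.
have [xi eta _] := rK k.
have {}fk := le_trans fk (ler_wpM2r (normr_ge0 _) (subgrad_le _ _ _ _ _ KA0 AK xi)).
have {}gk := le_trans gk (ler_wpM2r (normr_ge0 _) (subgrad_le _ _ _ _ _ KB0 BK eta)).
have /(effdomP f_proper)[a fa] := subdiff_effdom f_proper (x_optimality k).
have /(effdomP g_proper)[b gb] := subdiff_effdom g_proper (y_optimality k).
rewrite fa gb -EFinD /= in fk gk *; rewrite lee_fin opprD addrACA.
rewrite (le_trans (ler_normD _ _))// (le_trans (lerD fk gk))// mulrDr.
rewrite lerD// ler_wpM2r//.
  by rewrite -addrA lerDl addr_ge0 ?S0.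
by rewrite addrAC lerDr addr_ge0 ?S0.
Qed.

(** What remains once the multipliers are controlled: one and the same [ub]
    serves for boundedness, for the distance to the KKT set and as the limit. *)
Lemma convergence ub : kkt_point c A B f g ub ->
  strongly_convex f \/ bounded_below A -> strongly_convex g ->
  multiplier_controlled ub ->
  [/\ (exists K : R, forall k : nat, triple_norm (u k) <= K),
      (exists C : R, 0 < C /\ forall k : nat, (1 <= k)%N ->
         Gdist rho B P Q (u k) (kkt_zeros c A B f g)
           <= C * Gnorm rho B P Q (u k - u k.-1))
    & exists (C q : R) (udag : X * Y * Z),
        [/\ 0 < C, 0 < q < 1, kkt_point c A B f g udag
          & forall k : nat, (1 <= k)%N ->
              triple_norm (u k - udag) <= C * q ^+ k /\
              (`| objective f g (u k).1.1 (u k).1.2 - min_value c A B f g |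
                 <= (C * q ^+ k)%:E)%E]].
Proof.
move=> ub_kkt fA g_strong l_ctrl.
have [C [q [C0 /andP[q0 q1] rate]]] := linear_rate ub_kkt fA g_strong l_ctrl.
have [r err_le] : exists r, forall k,
    `|x k - ub.1.1| + `|y k - ub.1.2| + `|l k - ub.2| <= r.
  apply: (@bounded_from _ 1 _ C) => k; rewrite (le_trans (rate _ _))//.
  by rewrite ler_piMr ?(ltW C0)// exprn_ile1// ltW.
split.
- exists (r + (`|ub.1.1| + `|ub.1.2| + `|ub.2|)) => k.
  rewrite (le_trans (triple_norm_le _))//.
  have tri (V : hilbertType R) (v w : V) : `|v| <= `|v - w| + `|w|.
    by rewrite -{1}[v](subrK w) ler_normD.
  have := tri _ (x k) ub.1.1; have := tri _ (y k) ub.1.2.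
  by have := tri _ (l k) ub.2; have := err_le k; lra.
- have [K K0 eK] := error_bound ub_kkt fA g_strong l_ctrl.
  have [KG KG0 GK] := G_form_le.
  exists ((1 + KG) * K); split; first by rewrite mulr_gt0// ltr_wpDr ?ltW.
  case=> // k _ /=.
  apply: (@le_trans _ _ (Gnorm rho B P Q (u k.+1 - ub))).
    apply: ge_inf; first by exists 0 => _ [v _ <-]; exact: Gnorm_ge0.
    by exists ub => //; rewrite kkt_zerosE.
  rewrite -mulrA.
  apply: le_of_sqr_le; rewrite ?mulr_ge0 ?Gnorm_ge0 ?(ltW KG0) ?(ltW K0)//.
  rewrite sqr_Gnorm (le_trans (GK _))// ler_wpM2l ?(ltW KG0)//.
  by rewrite ler_pXn2r ?nnegrE ?addr_ge0 ?mulr_ge0 ?Gnorm_ge0 ?(ltW K0)// eK.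
- have [K K0 HK] := objective_error_le ub_kkt (ex_intro _ r err_le).
  exists ((1 + K) * C), q, ub; rewrite q0 q1.
  split=> //; first by rewrite mulr_gt0// ltr_wpDr ?ltW.
  case=> // k _; have ek := rate k.+1 isT.
  have q0k : 0 <= C * q ^+ k.+1 by rewrite mulr_ge0 ?exprn_ge0 ?ltW.
  split.
    rewrite (le_trans (triple_norm_le _))// (le_trans ek)//.
    by rewrite -mulrA ler_peMl// lerDl ltW.
  apply: le_trans (HK k) _; rewrite lee_fin -mulrA.
  apply: (@le_trans _ _ (K * (C * q ^+ k.+1))).
    by rewrite ler_wpM2l ?(ltW K0)// (le_trans _ ek)// lerDl.
  by rewrite ler_wpM2r// lerDr.
Qed.

End proximal_admm.

Theorem theorem2p11 (R : realType) (X Y Z : hilbertType R)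
  (rho : R) (c : Z) (A : {linear X -> Z}) (B : {linear Y -> Z})
  (P : {linear X -> X}) (Q : {linear Y -> Y})
  (f : X -> \bar R) (g : Y -> \bar R)
  (u : nat -> X * Y * Z) :
  0 < rho ->
  continuous A -> continuous B -> continuous P -> continuous Q ->
  psd_selfadjoint P -> psd_selfadjoint Q ->
  proper_fun f -> lower_semicontinuous f -> convex_fun f ->
  proper_fun g -> lower_semicontinuous g -> convex_fun g ->
  (exists ubar, kkt_point c A B f g ubar) ->
  proximal_admm rho c A B P Q f g u ->
  [\/ condition_i A B g, condition_ii B f g,
      condition_iii A B f g (u 0%N).2 | condition_iv A B f g (u 0%N).2] ->
  [/\ (exists K : R, forall k : nat, triple_norm (u k) <= K),
      (exists C : R, 0 < C /\ forall k : nat, (1 <= k)%N ->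
         Gdist rho B P Q (u k) (kkt_zeros c A B f g)
           <= C * Gnorm rho B P Q (u k - u k.-1))
    & exists (C q : R) (udag : X * Y * Z),
        [/\ 0 < C, 0 < q < 1, kkt_point c A B f g udag
          & forall k : nat, (1 <= k)%N ->
              triple_norm (u k - udag) <= C * q ^+ k /\
              (`| objective f g (u k).1.1 (u k).1.2 - min_value c A B f g |
                 <= (C * q ^+ k)%:E)%E]].
Proof.
move=> rho0 cA cB cP cQ P_psd Q_psd f_proper _ f_convex g_proper _ g_convex.
move=> [ub ub_kkt] u_admm conditions.
have A_below : coercive A -> bounded_below A.
  by apply: coercive_bounded_below => a v; rewrite linearZ_LR.
have Bs_below : coercive (adjoint B) -> bounded_below (adjoint B).
  by apply: coercive_bounded_below => a v; rewrite adjointZ.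
have B_ctrl : strongly_convex g -> bounded_below (adjoint B) -> diff_fun g ->
    lipschitz_gradient_bounded g -> multiplier_controlled rho B P Q u ub.
  move=> g_strong B_below gD glip.
  exact: (bounded_below_multiplier_controlled rho0 cA cB cP cQ P_psd Q_psd
    f_proper f_convex g_proper g_convex u_admm ub_kkt).
have [vb vb_kkt vb_perp] := kkt_point_ker_perp cA cB ub_kkt.
have conclude := convergence rho0 cA cB cP cQ P_psd Q_psd f_proper f_convex
  g_proper g_convex u_admm.
have perp_ctrl := ker_perp_multiplier_controlled rho0 cA cB cP cQ P_psd Q_psd
  f_proper f_convex g_proper g_convex u_admm vb_kkt vb_perp.
case: conditions => [[/convexity_modulus_gt0 g_strong /A_below A_bd /Bs_below]
  |[/convexity_modulus_gt0 f_strong /convexity_modulus_gt0 g_strong /Bs_below]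
  |[l0 /convexity_modulus_gt0 f_strong /convexity_modulus_gt0 g_strong Mco]
  |[l0 /convexity_modulus_gt0 g_strong /A_below A_bd Mco]].
- by move=> B_bd gD glip; apply: (conclude _ ub_kkt); [right| |exact: B_ctrl].
- by move=> B_bd gD glip; apply: (conclude _ ub_kkt); [left| |exact: B_ctrl].
- move=> [fD flip gD glip]; apply: (conclude _ vb_kkt); [by left|by []|].
  by apply: perp_ctrl => //; left.
- move=> [fD flip gD glip]; apply: (conclude _ vb_kkt); [by right|by []|].
  by apply: perp_ctrl => //; right.
Qed.
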